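(* Let $n\ge5$ and let $\boldsymbol\lambda\in K_n$ be such that $G_{\boldsymbol\lambda}$ is isomorphic to the tetrahedral group $T\simeq A_4$. According to the type of $\boldsymbol\lambda$, its multiplicity vector is: 1. type F+mB ($m\ge1$): $(m,\,1+m,\,m,\,3m)$; 2. type E+mB ($m\ge1$): $(m,\,m,\,m,\,1+3m)$; 3. type FV+mB ($m\ge1$): $(m,\,1+m,\,1+m,\,1+3m)$; 4. type FE+mB ($m\ge0$): $(m,\,1+m,\,m,\,2+3m)$; 5. type FVE+mB ($m\ge1$): $(m,\,1+m,\,1+m,\,3+3m)$; 6. type (1+m)B ($m\ge0$): $(m,\,1+m,\,1+m,\,2+3m)$.
   Context: $K_n=\{\boldsymbol\lambda=(\lambda^1,\dots,\lambda^{n-3})\in\mathbb{C}^{n-3}\mid \lambda^i\neq 0,1,\ \lambda^i\neq\lambda^j \text{ for } i\neq j\}$. For $\boldsymbol\lambda\in K_n$ put $z^{\boldsymbol\lambda}_1=0$, $z^{\boldsymbol\lambda}_2=1$, $z^{\boldsymbol\lambda}_3=\infty$, $z^{\boldsymbol\lambda}_{i+3}=\lambda^i$, and $[\boldsymbol\lambda]=\{z^{\boldsymbol\lambda}_1,\dots,z^{\boldsymbol\lambda}_n\}\subset\widehat{\mathbb{C}}$. For $\sigma\in S_n$, $f^{\boldsymbol\lambda}_\sigma$ is the unique linear fractional transformation (LFT) sending $z^{\boldsymbol\lambda}_{\sigma^{-1}(1)},z^{\boldsymbol\lambda}_{\sigma^{-1}(2)},z^{\boldsymbol\lambda}_{\sigma^{-1}(3)}$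 to $0,1,\infty$, and $g_\sigma:K_n\to K_n$, $g_\sigma(\boldsymbol\lambda)=(f^{\boldsymbol\lambda}_\sigma(z^{\boldsymbol\lambda}_{\sigma^{-1}(4)}),\dots,f^{\boldsymbol\lambda}_\sigma(z^{\boldsymbol\lambda}_{\sigma^{-1}(n)}))$. $G=\{g_\sigma\mid\sigma\in S_n\}$ is a group under composition ($g_\pi g_\sigma=g_{\pi\sigma}$; $G\simeq S_n$ for $n\ge5$), $G_{\boldsymbol\lambda}$ is the stabilizer of $\boldsymbol\lambda$ in $G$, $\mathcal{A}_{\alpha}$ is the group of LFTs preserving a set $\alpha$, and $\Phi_{\boldsymbol\lambda}:G_{\boldsymbol\lambda}\to\mathcal{A}_{[\boldsymbol\lambda]}$, $g_\sigma\mapsto f^{\boldsymbol\lambda}_\sigma$, is a group isomorphism. $X_{\boldsymbol\lambda}:G_{\boldsymbol\lambda}\to \mathrm{GL}_{n-3}(\mathbb{C})$ is the representation sending $g_\sigma$ to the Jacobian matrix of $g_\sigma$ at $\boldsymbol\lambda$. Types. Two subsets of $\widehat{\mathbb{C}}$ are equivalent if an LFT carries one onto the other. Put $w=e^{2\pi i/3}$ and $T=\langle z\mapsto wz,\ z\mapsto\frac{\sqrt2-z}{\sqrt2z+1}\rangle\simeq A_4$, the rotation group of a regular tetrahedron inscribed in $S^2\cong\widehat{\mathbb{C}}$ (stereographic projection) with vertex set $V_T=\{\infty,-\frac1{\sqrt2},-\frac{1}{\sqrt2}w,-\frac1{\sqrt2}w^2\}$; the projections to $S^2$, from the center, of its face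 centers are $F_T=\{0,\sqrt2,\sqrt2w,\sqrt2w^2\}$ and of its edge midpoints $E_T=\{\frac{\sqrt2}{1-\sqrt3}w^k,\frac{\sqrt2}{1+\sqrt3}w^k\mid k=0,1,2\}$. $B_T(a)$ denotes a $T$-orbit of order $12$. $\boldsymbol\lambda$ is of type F+mB, E+mB, FV+mB, FE+mB, FVE+mB if $[\boldsymbol\lambda]$ is equivalent to the union of, respectively, $F_T$; $E_T$; $F_T\cup V_T$; $F_T\cup E_T$; $F_T\cup V_T\cup E_T$ with $m$ different orbits of order $12$; it is of type (1+m)B if $[\boldsymbol\lambda]$ is equivalent to a union of $m+1$ different orbits of order $12$. (Every $\boldsymbol\lambda$ with $G_{\boldsymbol\lambda}\simeq T$ is of one of these types.) Multiplicity vector. $G_{\boldsymbol\lambda}\simeq A_4$ has four conjugacy classes: $K^{(1)}$ the identity, $K^{(2)}$ the elements of order two, and two classes of elements of order three, $K^{(3)}$ and $K^{(4)}$. For types E+mB, FV+mB, FVE+mB, (1+m)B, the labels $K^{(3)},K^{(4)}$ are assigned arbitrarily (the result does not depend on this). For types F+mB and FE+mB, let $\psi$ be an LFT carrying $[\boldsymbol\lambda]$ onto the corresponding union of $F_T$ (respectively $F_T\cup E_T$) with $m$ orbits of order $12$, and let $\rho\in G_{\boldsymbol\lambda}$ be the element with $\psi\circ\Phi_{\boldsymbol\lambda}(\rho)\circ\psi^{-1}(z)=wz$; then $K^{(3)}$ is the class of $\rho$ and $K^{(4)}$ the class of $\rho^2$ (the result does not depend on $\psi$). The irreducible representations $X^{(1)},\dots,X^{(4)}$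 have characters with values on $(K^{(1)},\dots,K^{(4)})$: $\chi^{(1)}=(1,1,1,1)$, $\chi^{(2)}=(1,1,w,w^2)$, $\chi^{(3)}=(1,1,w^2,w)$, $\chi^{(4)}=(3,-1,0,0)$. If $X_{\boldsymbol\lambda}\cong p_1X^{(1)}\oplus\cdots\oplus p_4X^{(4)}$, the multiplicity vector of $\boldsymbol\lambda$ is $(p_1,p_2,p_3,p_4)$.
   Formalization: In item 6 the multiplicity vector of type (1+m)B is corrected to (1+m, 1+m, 1+m, 2+3m): here n = 12(1+m), so the degrees must add up to n−3 = 9+12m, whereas the printed vector gives 8+12m. *)

(* Defs.v *)
From HB Require Import structures.
From mathcomp Require Import all_boot all_order all_algebra all_fingroup.
From mathcomp Require Import all_classical all_reals all_analysis.
From mathcomp Require Import complex.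

Set Implicit Arguments.
Unset Strict Implicit.
Unset Printing Implicit Defensive.

Import Order.TTheory GRing.Theory Num.Theory.
Import numFieldNormedType.Exports.

Local Open Scope classical_set_scope.
Local Open Scope ring_scope.
Local Open Scope complex_scope.

Section GroupsOfMaps.
Context {X : Type}.

Definition is_map_group (H : set (X -> X)) : Prop :=
  [/\ H id,
      forall f g, H f -> H g -> H (f \o g)
    & forall f, H f -> exists g, [/\ H g, g \o f = id & f \o g = id]].

Definition generated_group (S : set (X -> X)) : set (X -> X) :=
  smallest is_map_group S.

Definition conj_class (H : set (X -> X)) (r : X -> X) : set (X -> X) :=
  [set s | H s /\ exists2 h, H h & h \o r = s \o h].

Definition order_two (H : set (X -> X)) : set (X -> X) :=
  [set r | [/\ H r, r <> id & r \o r = id]].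

Definition order_three (H : set (X -> X)) : set (X -> X) :=
  [set r | [/\ H r, r <> id & r \o r \o r = id]].

Definition order3_labelling (H K3 K4 : set (X -> X)) : Prop :=
  K3 <> K4 /\
  exists r s, [/\ order_three H r, order_three H s,
                  K3 = conj_class H r & K4 = conj_class H s].

End GroupsOfMaps.

Definition group_iso {X Y : Type} (H : set (X -> X)) (K : set (Y -> Y)) : Prop :=
  exists phi : (X -> X) -> (Y -> Y),
    set_bij H K phi /\
    forall f g, H f -> H g -> phi (f \o g) = phi f \o phi g.

Section Representations.
Context {X : Type} {F : fieldType}.
Implicit Types H : set (X -> X).

Definition is_rep H d (rho : (X -> X) -> 'M[F]_d) : Prop :=
  rho id = 1%:M /\
  forall f g, H f -> H g -> rho (f \o g) = rho f *m rho g.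

Definition is_irreducible_rep H d (rho : (X -> X) -> 'M[F]_d) : Prop :=
  [/\ (0 < d)%N, is_rep H rho
    & forall W : {vspace 'cV[F]_d},
        (forall g v, H g -> v \in W -> rho g *m v \in W) ->
        W = 0%VS \/ W = fullv].

(* The equality of degrees avoids casts, as in mx_rsim. *)
Definition rep_equiv H d1 d2 (rho1 : (X -> X) -> 'M[F]_d1)
    (rho2 : (X -> X) -> 'M[F]_d2) : Prop :=
  exists B : 'M[F]_(d1, d2),
    [/\ d1 = d2, row_free B
      & forall g, H g -> rho1 g *m B = B *m rho2 g].

End Representations.

Section Setting.
Context {R : realType}.
Local Notation C := R[i].

(* The Riemann sphere: None is the point at infinity. *)
Definition sphere : Type := option C.

Definition lft (a b c d : C) (z : sphere) : sphere :=
  match z with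
  | Some z => if c * z + d == 0 then None else Some ((a * z + b) / (c * z + d))
  | None => if c == 0 then None else Some (a / c)
  end.

Definition is_lft (f : sphere -> sphere) : Prop :=
  exists a b c d : C, a * d - b * c != 0 /\ f = lft a b c d.

Section ConfigurationSpace.
(* n = 3 + d, so that K_n lies in C^d. *)
Context {d : nat}.
Local Notation V := 'rV[C]_d.

Definition Kn : set V :=
  [set lam | (forall i, lam 0 i != 0 /\ lam 0 i != 1) /\
             (forall i j, i != j -> lam 0 i != lam 0 j)].

Definition zero_one_infty (k : 'I_3) : sphere :=
  tnth [tuple Some 0; Some 1; None] k.

Definition zpt (lam : V) (i : 'I_(3 + d)) : sphere :=
  match fintype.split i with
  | inl k => zero_one_infty k
  | inr j => Some (lam 0 j)
  end.

Definition zset (lam : V) : set sphere := range (zpt lam).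

(* The default value id is only reached outside of K_n, where the required
   linear fractional transformation may fail to exist. *)
Definition f_ (s : {perm 'I_(3 + d)}) (lam : V) : sphere -> sphere :=
  xget (id : sphere -> sphere) [set f | is_lft f /\
    forall k : 'I_3, f (zpt lam ((s^-1)%g (lshift d k))) = zero_one_infty k].

(* Self-maps of K_n are extended by the identity to C^d: this preserves both
   equality and composition of maps, and, K_n being open, derivatives at the
   points of K_n. *)
Definition g_ (s : {perm 'I_(3 + d)}) (lam : V) : V :=
  if lam \in Kn then
    \row_(j < d) odflt 0 (f_ s lam (zpt lam ((s^-1)%g (rshift 3 j))))
  else lam.

Definition G : set (V -> V) := range g_.

Definition stabilizer (lam : V) : set (V -> V) :=
  [set h | G h /\ h lam = lam].

(* The graph of Phi_lam. *)
Definition Phi_graph (lam : V) (h : V -> V) (f : sphere -> sphere) : Prop :=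
  exists s, h = g_ s /\ f = f_ s lam.

(* The library's jacobian acts on row vectors from the right; its transpose is
   the matrix of the partial derivatives (d g_i / d lam^j)_(i, j), for which
   the chain rule reads J (g \o h) = J g *m J h. *)
Definition X_ (lam : V) (h : V -> V) : 'M[C]_d := (jacobian h lam)^T.

End ConfigurationSpace.

(* w = exp(2 pi i / 3) *)
Definition w : C := cos (2 * pi / 3) +i* sin (2 * pi / 3).

Definition sqrt2 : C := (Num.sqrt 2)%:C.
Definition sqrt3 : C := (Num.sqrt 3)%:C.

Definition rot_w : sphere -> sphere := lft w 0 0 1.

Definition T : set (sphere -> sphere) :=
  generated_group [set rot_w; lft (- 1) sqrt2 sqrt2 1].

Definition V_T : set sphere :=
  None |` [set Some (- (1 / sqrt2) * w ^+ k) | k in `I_3].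

Definition F_T : set sphere :=
  Some 0 |` [set Some (sqrt2 * w ^+ k) | k in `I_3].

Definition E_T : set sphere :=
  [set Some (sqrt2 / (1 - sqrt3) * w ^+ k) | k in `I_3] `|`
  [set Some (sqrt2 / (1 + sqrt3) * w ^+ k) | k in `I_3].

Definition T_orbit (a : sphere) : set sphere := [set t a | t in T].

Definition is_B_T (B : set sphere) : Prop :=
  (exists a, B = T_orbit a) /\ (B #= `I_12)%card.

Definition is_plus_mB (A : set sphere) (m : nat) (S : set sphere) : Prop :=
  exists B : 'I_m -> set sphere,
    [/\ injective B, forall i, is_B_T (B i)
      & S = A `|` \bigcup_(i in [set: 'I_m]) B i].

Section Types.
Context {d : nat}.
Local Notation V := 'rV[C]_d.

Definition carries_onto_type (psi : sphere -> sphere) (lam : V)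
    (A : set sphere) (m : nat) : Prop :=
  is_lft psi /\ is_plus_mB A m [set psi z | z in zset lam].

Definition has_type (lam : V) (A : set sphere) (m : nat) : Prop :=
  exists psi, carries_onto_type psi lam A m.

(* psi \o Phi_lam(rho) \o psi^-1 = (z |-> w z), with psi^-1 moved to the
   right-hand side. *)
Definition is_distinguished_rotation (psi : sphere -> sphere) (lam : V)
    (rho : V -> V) : Prop :=
  stabilizer lam rho /\
  exists2 f, Phi_graph lam rho f & psi \o f = rot_w \o psi.

Definition conj_classes_A4 (lam : V) (K3 K4 : set (V -> V)) :
    'I_4 -> set (V -> V) :=
  tnth [tuple [set id]; order_two (stabilizer lam); K3; K4].

Definition chi (i k : 'I_4) : C :=
  tnth (tnth [tuple [tuple 1; 1; 1; 1];
                    [tuple 1; 1; w; w ^+ 2];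
                    [tuple 1; 1; w ^+ 2; w];
                    [tuple 3; - 1; 0; 0]] i) k.

Definition multiplicity_vector (lam : V) (K3 K4 : set (V -> V))
    (p1 p2 p3 p4 : nat) : Prop :=
  exists (deg : 'I_4 -> nat) (X : forall i, (V -> V) -> 'M[C]_(deg i)),
    (forall i, is_irreducible_rep (stabilizer lam) (X i) /\
       forall k g, conj_classes_A4 lam K3 K4 k g -> \tr (X i g) = chi i k) /\
    rep_equiv (stabilizer lam) (X_ lam)
      (fun g => \mxdiag_(i < 4)
                  \mxdiag_(_ < tnth [tuple p1; p2; p3; p4] i) X i g).

End Types.

End Setting.

(* Main.v *)
Require Import Defs.
From mathcomp Require Import all_boot all_order all_algebra all_fingroup.
From mathcomp Require Import all_classical all_reals all_analysis.
From mathcomp Require Import complex.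
From mathcomp Require Import zify ring lra.

Set Implicit Arguments.
Unset Strict Implicit.
Unset Printing Implicit Defensive.

Import Order.TTheory GRing.Theory Num.Theory.
Import numFieldNormedType.Exports.

(** A tangent vector at a configuration moves its n marked points on the sphere,
    and two motions are identified when they differ by a vector field in the
    Lie algebra of the group of linear fractional transformations.  So the
    tangent space of K_n at lam is the sum of the tangent lines at the marked
    points modulo a three-dimensional space of quadratic vector fields, and an
    element of the stabilizer acts on it through the corresponding symmetry f
    of the configuration.  Its character is therefore the sum, over the marked
    points fixed by f, of the derivatives of f at these points, minus the trace
    of the adjoint action of f ([mxtrace_X_g]; the computation is a derivative
    of cross ratios, [is_derive_cross_ratio]).

    For the tetrahedral group this is explicit.  A half turn has multiplier -1 at
    each of its two fixed points, a pair of opposite edge midpoints, and its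
    adjoint trace is -1.  The rotation z |-> w z has multipliers w at the face
    center 0 and w^2 at the vertex at infinity, and its adjoint trace is 0.  The
    orbits of order twelve are free, so they have no fixed points and only affect
    the dimension d = n - 3.  If kF, kV, kE are 0 or 1 according to which of the
    orbits F, V, E are present, then
      d = 4 kF + 4 kV + 6 kE + 12 m - 3,
    the character is 1 - 2 kE at a half turn and w kF + w^2 kV at z |-> w z
    ([carried_card], [mxtrace_a], [mxtrace_r]), and scalar products with
    the irreducible characters give the multiplicities
      (m, m + kF, m + kV, 3 m + kF + kV + 2 kE - 1).

    Two points need an argument besides this computation.  First, the stabilizer
    has to consist of the lifts of the rotations of the tetrahedron: the lifting
    map [lift_trot] is a morphism from A4 to the stabilizer, it is injective
    because the trace of a half turn is not d, and it is onto because both groups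
    have twelve elements.  Second, equality of characters has to be turned into
    an equivalence of representations.  For A4 this is done directly
    ([a4_mx_decomposition]): the projectors onto the three characters of degree
    one and onto the nontrivial eigenspaces of the Klein group are explicit, their
    ranks are given by traces, and bases of their images are assembled into the
    intertwining matrix. *)

(** * Words in generators of the alternating group A4 *)

Section A4Words.
Local Open Scope ring_scope.

(** A4 is the semidirect product of a Klein group, written additively on pairs
    of booleans, by a cyclic group of order three which permutes the three
    involutions cyclically, by [klein_turn].  This explicit model makes every
    question about the multiplication of A4 a finite case analysis. *)
Definition a4 : Type := ((bool * bool) * 'Z_3)%type.

Definition klein_add (u v : bool * bool) := (u.1 (+) v.1, u.2 (+) v.2).
Definition klein_turn (u : bool * bool) := (u.2, u.1 (+) u.2).

Definition a4_mul (x y : a4) : a4 :=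
  (klein_add x.1 (iter x.2 klein_turn y.1), x.2 + y.2).
Definition a4_inv (x : a4) : a4 := (iter (- x.2) klein_turn x.1, - x.2).
Definition a4_one : a4 := ((false, false), 0).

(** A presentation of A4: [a] and [b] generate a Klein group, and conjugation
    by [r] sends [a] to [b] and [b] to [a b].  The operation is an arbitrary
    monoid law because it is used for composition of maps and for products of
    matrices alike. *)
Record a4_relations (S : Type) (op : S -> S -> S) (one a b r : S) : Prop :=
  A4Relations {
    a4r_assoc : associative op;
    a4r_1l : left_id one op;
    a4r_1r : right_id one op;
    a4r_aa : op a a = one;
    a4r_bb : op b b = one;
    a4r_ba : op b a = op a b;
    a4r_rrr : op r (op r r) = one;
    a4r_ra : op r a = op b r;
    a4r_rb : op r b = op (op a b) r }.

Definition klein_word (S : Type) (op : S -> S -> S) (one a b : S)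
    (u : bool * bool) : S :=
  op (if u.1 then a else one) (if u.2 then b else one).

Definition a4_word (S : Type) (op : S -> S -> S) (one a b r : S) (x : a4) : S :=
  op (klein_word op one a b x.1) (iter x.2 (op r) one).

Lemma Z3_ind (P : 'Z_3 -> Prop) : P 0 -> P 1 -> P (- 1) -> forall k, P k.
Proof.
move=> P0 P1 P2; case=> [[|[|[|k]]] lt_k] //.
- by rewrite (_ : Ordinal _ = 0) //; apply: val_inj.
- by rewrite (_ : Ordinal _ = 1) //; apply: val_inj.
- by rewrite (_ : Ordinal _ = - 1) //; apply: val_inj.
Qed.

Lemma klein_add_eq0 u v : klein_add u v = (false, false) -> u = v.
Proof. by case: u v => [[] []] [[] []]. Qed.

Lemma klein_turn_fix k u : k != 0 :> 'Z_3 -> iter k klein_turn u = u ->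
  u = (false, false).
Proof. by elim/Z3_ind: k => //=; case: u => [[] []]. Qed.

Lemma a4_eq (x y : a4) : x.1 = y.1 -> x.2 = y.2 :> nat -> x = y.
Proof. by case: x y => [u j] [v k] /= -> /val_inj ->. Qed.

Lemma a4_mulV x : a4_mul x (a4_inv x) = a4_one.
Proof.
case: x => u k; rewrite /a4_mul /a4_inv /a4_one /= subrr; congr (_, _).
by elim/Z3_ind: k; case: u => [[] []].
Qed.

Lemma a4_mulVl x : a4_mul (a4_inv x) x = a4_one.
Proof.
case: x => u k; rewrite /a4_mul /a4_inv /a4_one /= addNr; congr (_, _).
by rewrite /klein_add !addbb.
Qed.

Lemma a4_mulV_eq1 x y : a4_mul x (a4_inv y) = a4_one -> x = y.
Proof.
case: x y => u j [v k] eq1.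
have eq_jk : j = k by apply: subr0_eq; exact: (congr1 (fun z : a4 => z.2) eq1).
move: (congr1 (fun z : a4 => z.1) eq1); rewrite {}eq_jk {eq1} /= => eq1; congr (_, _).
by elim/Z3_ind: k eq1; case: u v => [[] []] [[] []].
Qed.

Section Words.
Context {S : Type} {op : S -> S -> S} {one a b r : S}.
Context (rel : a4_relations op one a b r).
Local Notation V := (klein_word op one a b).
Local Notation e := (a4_word op one a b r).
Local Notation pw k := (iter k (op r) one).

Let assoc := a4r_assoc rel.
Let one_l := a4r_1l rel.
Let one_r := a4r_1r rel.

Lemma klein_wordD u v : op (V u) (V v) = V (klein_add u v).
Proof.
have aak x : op a (op a x) = x by rewrite assoc (a4r_aa rel) one_l.
have bbk x : op b (op b x) = x by rewrite assoc (a4r_bb rel) one_l.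
have bak x : op b (op a x) = op a (op b x) by rewrite !assoc (a4r_ba rel).
by case: u v => [[] []] [[] []]; rewrite /klein_word /klein_add /=;
  do ?rewrite -!assoc;
  do ?rewrite ?one_l ?one_r ?bak ?(a4r_ba rel) ?aak ?bbk ?(a4r_aa rel) ?(a4r_bb rel).
Qed.

Lemma klein_word_turn u : op r (V u) = op (V (klein_turn u)) r.
Proof.
have bbk x : op b (op b x) = x by rewrite assoc (a4r_bb rel) one_l.
case: u => [[] []]; rewrite /klein_word /klein_turn /= ?one_l ?one_r //.
- rewrite assoc (a4r_ra rel) -assoc (a4r_rb rel) assoc; congr (op _ r).
  by rewrite assoc (a4r_ba rel) -assoc (a4r_bb rel) one_r.
- by rewrite (a4r_ra rel).
- by rewrite (a4r_rb rel).
Qed.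

Lemma pw_turn k u : op (pw k) (V u) = op (V (iter k klein_turn u)) (pw k).
Proof.
elim: k u => [|k IH] u /=; first by rewrite one_l one_r.
by rewrite -assoc IH assoc klein_word_turn -assoc.
Qed.

Lemma pwD j k : op (pw j) (pw k) = pw (j + k)%N.
Proof. by elim: j => [|j IH] /=; [by rewrite one_l|by rewrite -assoc IH]. Qed.

Lemma pw_mod3 k : pw (k %% 3) = pw k.
Proof.
rewrite {2}(divn_eq k 3) addnC; elim: (k %/ 3)%N => [|q IH]; first by rewrite addn0.
by rewrite mulSn addnCA /= -IH !assoc -[op (op r r) r]assoc (a4r_rrr rel) one_l.
Qed.

Lemma a4_wordM x y : op (e x) (e y) = e (a4_mul x y).
Proof.
have pwE : pw (a4_mul x y).2 = op (pw x.2) (pw y.2) by rewrite pwD -[RHS]pw_mod3.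
rewrite /a4_word pwE /= -klein_wordD.
have := pw_turn x.2 y.1.
move: (V x.1) (V y.1) (V _) (pw x.2) (pw y.2) => u v v' s t sv.
by rewrite -!assoc (assoc s) sv -!assoc.
Qed.

Lemma a4_word1 : e a4_one = one.
Proof. by rewrite /a4_word /klein_word /= !one_l. Qed.

(** The three involutions of the Klein group are conjugate under [r], so if one
    of them were trivial then [a] would be trivial as well. *)
Lemma klein_word_eq1 u : a <> one -> V u = one -> u = (false, false).
Proof.
move=> a1.
have r_inj x y : op x r = op y r -> x = y.
  move=> /(congr1 (op^~ (op r r))).
  by rewrite -!assoc (a4r_rrr rel) !one_r.
have turn_eq1 v : V v = one -> V (klein_turn v) = one.
  by move=> v1; apply: r_inj; rewrite -klein_word_turn v1 one_r one_l.
have V10 : V (true, false) = a by rewrite /klein_word /= one_r.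
case: u => [[] []] // u1; case: a1; rewrite -V10 //.
- exact: (turn_eq1 _ u1).
- exact: (turn_eq1 _ (turn_eq1 _ u1)).
Qed.

(** A word in the kernel with a nontrivial power of [r] would commute with the
    Klein group, on which that power of [r] has no nonzero fixed vector; this
    would put an involution in the kernel. *)
Lemma a4_word_inj : a <> one -> injective e.
Proof.
move=> a1 x y exy; apply: a4_mulV_eq1.
have: e (a4_mul x (a4_inv y)) = one by rewrite -a4_wordM exy a4_wordM a4_mulV a4_word1.
move: (a4_mul _ _) => [u k] {x y exy} uk1.
have [k0|k0] := eqVneq k 0.
  move: uk1; rewrite k0 /a4_word /= one_r => /(klein_word_eq1 a1) -> //.
pose v := (true, false).
have: V (klein_add v (iter k klein_turn v)) = one.
  have kleinC w : op (V u) (V w) = op (V w) (V u).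
    by rewrite !klein_wordD /klein_add addbC [u.2 (+) _]addbC.
  have fixv : V (iter k klein_turn v) = V v.
    have uk1' : op (V u) (pw k) = one by exact: uk1.
    have := pw_turn k v; have := kleinC (iter k klein_turn v).
    move: (V u) (pw k) (V _) (V _) uk1' => s t v1 v2 st sv1 tv2.
    by rewrite -[v1]one_r -st assoc -sv1 -assoc -tv2 assoc st one_l.
  by rewrite -klein_wordD fixv klein_wordD /klein_word /= one_l.
move=> /(klein_word_eq1 a1) /klein_add_eq0/esym/(klein_turn_fix k0) //.
Qed.

End Words.

Section Morphisms.
Context {S : Type} {op : S -> S -> S} {one : S} {theta : a4 -> S}.
Context (thetaM : forall x y, op (theta x) (theta y) = theta (a4_mul x y)).
Context (theta1 : theta a4_one = one).
Local Notation a := (theta ((true, false), 0)).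
Local Notation b := (theta ((false, true), 0)).
Local Notation r := (theta ((false, false), 1)).

(** A morphism defined on the model is determined by its values on the
    generators; this turns a map given element by element into a system of
    generators satisfying the relations. *)
Lemma a4_morphism_word x : theta x = a4_word op one a b r x.
Proof.
case: x => u k; rewrite /a4_word /klein_word /= -theta1.
by elim/Z3_ind: k; case: u => [[] []]; rewrite /= !thetaM;
  congr theta; apply: a4_eq.
Qed.

Lemma a4_morphism_relations : associative op -> left_id one op -> right_id one op ->
  a4_relations op one a b r.
Proof.
by move=> assoc one_l one_r; split => //; rewrite ?thetaM -?theta1; congr theta; apply: a4_eq.
Qed.

End Morphisms.

End A4Words.

(** * Splitting a matrix representation of A4 *)

Section A4Matrices.
Local Open Scope ring_scope.

Lemma root_cube (F : comNzRingType) (u : F) : u ^+ 2 + u + 1 = 0 -> u ^+ 3 = 1.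
Proof.
move=> u_root; apply/eqP; rewrite -subr_eq0.
rewrite [X in X == _](_ : _ = (u - 1) * (u ^+ 2 + u + 1)); last by ring.
by rewrite u_root mulr0.
Qed.

(** If [P = C D] is a rank factorization of an idempotent then [D C] is the
    identity, so that the trace of [P] is its rank.  The columns of [C] form a
    basis of the image of [P]. *)
Lemma trace_idempotent_factor (F : numFieldType) d (P : 'M[F]_d) p :
  P *m P = P -> \tr P = p%:R ->
  exists (C : 'M[F]_(d, p)) (D : 'M[F]_(p, d)), C *m D = P /\ P *m C = C.
Proof.
move=> PP trP.
have DC : row_base P *m col_base P = 1%:M.
  apply: (row_free_inj (row_base_free P)); rewrite mul1mx.
  apply: (row_full_inj (col_base_full P)).
  move: (row_base P) (col_base P) (mulmx_base P) => D C eqP.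
  by rewrite !mulmxA eqP -mulmxA eqP.
suff <- : \rank P = p.
  exists (col_base P), (row_base P); split; first exact: mulmx_base.
  by rewrite -[X in X *m _ = _]mulmx_base -mulmxA DC mulmx1.
apply/eqP; rewrite -(eqr_nat F) -trP -[in X in _ == X](mulmx_base P).
by rewrite mxtrace_mulC DC mxtrace1.
Qed.

Lemma mulmx_sum_col_row (F : fieldType) m p n (C : 'M[F]_(m, p)) (D : 'M[F]_(p, n)) :
  \sum_j col j C *m row j D = C *m D.
Proof.
apply/matrixP => i k; rewrite summxE mxE; apply: eq_bigr => j _.
by rewrite !mxE big_ord1 !mxE.
Qed.

Section Columns3.
Context {F : fieldType} {d : nat}.

Definition cols3 (u0 u1 u2 : 'cV[F]_d) : 'M[F]_(d, 3) :=
  \matrix_(i, k) nth u2 [:: u0; u1] k i 0.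

Lemma mul_mx_cols3 (M : 'M[F]_d) u0 u1 u2 :
  M *m cols3 u0 u1 u2 = cols3 (M *m u0) (M *m u1) (M *m u2).
Proof.
apply/matrixP => i [[|[|[|k]]] lt_k] //; rewrite !mxE /= ?mxE;
  by apply: eq_bigr => l _; rewrite !mxE.
Qed.

Lemma mul_cols3_tr n u0 u1 u2 (v0 v1 v2 : 'rV[F]_n) :
  cols3 u0 u1 u2 *m \matrix_(k < 3, j < n) (nth v2 [:: v0; v1] k 0 j) =
  u0 *m v0 + u1 *m v1 + u2 *m v2.
Proof.
apply/matrixP => i k; rewrite !mxE !big_ord_recl !big_ord0 !mxE /= addr0.
by rewrite !addr0 addrA.
Qed.

End Columns3.

Section Irreducibles.
Context {F : fieldType}.

Definition a4irr_deg (m : nat) : nat := if m is 3 then 3 else 1.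

(** The representation of degree three is the rotation group of a tetrahedron
    inscribed in a cube with faces orthogonal to the coordinate axes: the
    involutions are the half turns about the axes, and the elements of order
    three permute the axes. *)
Definition half_turn (k0 : 'I_3) : 'M[F]_3 :=
  diag_mx (\row_k (if k == k0 then 1 else - 1)).
Definition axes_cycle : 'M[F]_3 :=
  \matrix_(i, j) (if (i : nat) == (j.+1 %% 3)%N then 1 else 0).

Definition a4irr3 : a4 -> 'M[F]_3 :=
  a4_word mulmx 1%:M (half_turn 0) (half_turn 1) axes_cycle.

(** The irreducible representations, in the order of the character table.  The
    degree is a function of a natural number, and not of an ordinal, for it to
    reduce in each of the four cases. *)
Definition a4irr (w : F) (m : nat) : a4 -> 'M[F]_(a4irr_deg m) :=
  match m as m0 return a4 -> 'M[F]_(a4irr_deg m0) with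
  | 3 => a4irr3
  | m => fun x => (w ^+ (m * x.2)%N)%:M
  end.

Lemma mul_cols3_half_turn0 d (u0 u1 u2 : 'cV[F]_d) :
  cols3 u0 u1 u2 *m half_turn 0 = cols3 u0 (- u1) (- u2).
Proof.
rewrite mul_mx_diag; apply/matrixP => i [[|[|[|k]]] lt_k] //;
  by rewrite !mxE /= ?mxE ?mulr1 ?mulrN1.
Qed.

Lemma mul_cols3_half_turn1 d (u0 u1 u2 : 'cV[F]_d) :
  cols3 u0 u1 u2 *m half_turn 1 = cols3 (- u0) u1 (- u2).
Proof.
rewrite mul_mx_diag; apply/matrixP => i [[|[|[|k]]] lt_k] //;
  by rewrite !mxE /= ?mxE ?mulr1 ?mulrN1.
Qed.

Lemma mul_cols3_axes_cycle d (u0 u1 u2 : 'cV[F]_d) :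
  cols3 u0 u1 u2 *m axes_cycle = cols3 u1 u2 u0.
Proof.
apply/matrixP => i [[|[|[|k]]] lt_k] //;
  by rewrite !mxE !big_ord_recl big_ord0 !mxE /= ?mulr0 ?mulr1 ?add0r ?addr0.
Qed.

Lemma a4irr3_relations :
  a4_relations mulmx 1%:M (half_turn 0) (half_turn 1) axes_cycle.
Proof.
split; try by move=> *; rewrite ?mulmxA ?mul1mx ?mulmx1.
all: apply/matrixP => i j; do ?rewrite !mxE; do ?rewrite !big_ord_recl !big_ord0 /=.
all: do ?rewrite !mxE; do ?rewrite !big_ord_recl !big_ord0 /=; do ?rewrite !mxE.
all: case: i => [[|[|[|i]]] lt_i] //; case: j => [[|[|[|j]]] lt_j] //.
all: rewrite /= ?mulr0n ?mulr1n ?mul1r ?mul0r ?mulr0 ?mulr1 ?addr0 ?add0r ?mulrNN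
  ?mulN1r ?mulr1 ?opprK ?mul0r ?addr0 //.
Qed.

Lemma a4irrM w m : w ^+ 3 = 1 ->
  forall x y, a4irr w m (a4_mul x y) = a4irr w m x *m a4irr w m y.
Proof.
move=> w3 x y.
have scal n : (w ^+ (n * (a4_mul x y).2)%N)%:M =
    (w ^+ (n * x.2)%N)%:M *m (w ^+ (n * y.2)%N)%:M :> 'M[F]_1.
  rewrite -scalar_mxM -exprD -mulnDr; congr (_ %:M).
  rewrite !(mulnC n) !exprM; congr (_ ^+ n).
  have -> : ((a4_mul x y).2 = (x.2 + y.2) %% 3 :> nat)%N by [].
  by rewrite [in RHS](divn_eq (x.2 + y.2) 3) exprD mulnC exprM w3 expr1n mul1r.
case: m => [|[|[|[|m]]]]; try exact: scal.
by rewrite /= /a4irr3 a4_wordM //; exact: a4irr3_relations.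
Qed.

Lemma a4irr1 w m : a4irr w m a4_one = 1%:M.
Proof.
case: m => [|[|[|[|m]]]]; rewrite /= ?muln0 ?expr0 //.
by rewrite /a4irr3 a4_word1 //; exact: a4irr3_relations.
Qed.

(** It is enough to check an intertwining relation on the generators. *)
Lemma a4_word_intertwine d1 d2 (A B R : 'M[F]_d1) (A' B' R' : 'M[F]_d2)
    (C : 'M[F]_(d1, d2)) :
  A *m C = C *m A' -> B *m C = C *m B' -> R *m C = C *m R' ->
  forall x, a4_word mulmx 1%:M A B R x *m C = C *m a4_word mulmx 1%:M A' B' R' x.
Proof.
move=> AC BC RC [[u v] k]; rewrite /a4_word /klein_word /=.
have RkC : iter k (mulmx R) 1%:M *m C = C *m iter k (mulmx R') 1%:M.
  elim: (k : nat) => [|j IH] /=; first by rewrite mul1mx mulmx1.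
  by rewrite -mulmxA IH !mulmxA RC.
have AC' : (if u then A else 1%:M) *m C = C *m (if u then A' else 1%:M).
  by case: u; rewrite ?mul1mx ?mulmx1.
have BC' : (if v then B else 1%:M) *m C = C *m (if v then B' else 1%:M).
  by case: v; rewrite ?mul1mx ?mulmx1.
by rewrite -!mulmxA RkC !mulmxA -(mulmxA _ _ C) BC' !mulmxA AC'.
Qed.

End Irreducibles.

Section Decomposition.
Context {F : numFieldType} {d : nat}.
Context (w : F) (w_root : w ^+ 2 + w + 1 = 0).
Context (A B R : 'M[F]_d) (rel : a4_relations mulmx 1%:M A B R).

Let AA : A * A = 1 := a4r_aa rel.
Let BB : B * B = 1 := a4r_bb rel.
Let BA : B * A = A * B := a4r_ba rel.
Let RRR : R * (R * R) = 1 := a4r_rrr rel.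
Let RA : R * A = B * R := a4r_ra rel.
Let RB : R * B = A * B * R := a4r_rb rel.

Let scaleAl (k : F) (X Y : 'M[F]_d) : k *: (X * Y) = k *: X * Y := scalemxAl k X Y.
Let scaleAr (k : F) (X Y : 'M[F]_d) : k *: (X * Y) = X * (k *: Y) := scalemxAr k X Y.

Let w3 : w ^+ 3 = 1 := root_cube w_root.

Let AB_conj : A * B * (A * B) = 1.
Proof. by rewrite -mulrA [B * _]mulrA BA -mulrA BB mulr1 AA. Qed.

(* Up to the factors 1/4, 1/4 and 1/3, these are the projections onto the
   vectors fixed by the Klein group, onto the vectors on which A acts as 1 and
   B as -1, and onto the eigenvectors of R for the eigenvalue u^-1 = u^2. *)
Let S4 := 1 + A + B + A * B.
Let Q4 := 1 + A - B - A * B.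
Let T3 (u : F) := 1 + u *: R + (u ^+ 2) *: (R * R).

Let AS : A * S4 = S4.
Proof.
by rewrite /S4 !mulrDr mulr1 mulrA AA mul1r [A + 1]addrC -addrA [A * B + B]addrC addrA.
Qed.

Let BS : B * S4 = S4.
Proof.
rewrite /S4 !mulrDr mulr1 mulrA BA BB -mulrA BB mulr1.
by rewrite [LHS](ACl (3*4*1*2)).
Qed.

Let RAB : R * (A * B) = A * R.
Proof. by rewrite mulrA RA -mulrA RB mulrA mulrA BA -(mulrA A B B) BB mulr1. Qed.

Let RS : R * S4 = S4 * R.
Proof. by rewrite /S4 !mulrDr RA RB RAB !mulrDl mulr1 mul1r [LHS](ACl (1*4*2*3)). Qed.

Let ST_idem u : u ^+ 3 = 1 -> S4 * T3 u * (S4 * T3 u) = 12%:R *: (S4 * T3 u).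
Proof.
move=> u3.
have TS : T3 u * S4 = S4 * T3 u.
  rewrite /T3; move: S4 RS => S SR.
  rewrite !mulrDr !mulrDl mulr1 mul1r -!scaleAl -!scaleAr SR.
  by rewrite -(mulrA R R) SR !mulrA SR.
have SS : S4 * S4 = 4%:R *: S4.
  rewrite {1}/S4; move: S4 AS BS => S A_S B_S.
  rewrite !mulrDl mul1r -mulrA B_S !A_S.
  by rewrite -!mulr2n -mulrSr -mulrSr scaler_nat.
have TT : T3 u * T3 u = 3%:R *: T3 u.
  have RT : u *: R * T3 u = T3 u.
    rewrite {1}/T3 !mulrDr mulr1 -!scaleAl -!scaleAr RRR !scalerA -expr2 -exprS u3 scale1r.
    by rewrite /T3 [LHS](ACl (3*1*2)).
  rewrite {1}/T3 !mulrDl mul1r RT.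
  have -> : u ^+ 2 *: (R * R) = u *: R * (u *: R).
    by rewrite -scaleAl -scaleAr scalerA.
  by rewrite -(mulrA _ _ (T3 u)) !RT -mulr2n -mulrSr scaler_nat.
rewrite mulrA -(mulrA S4) TS (mulrA S4) SS -!scaleAl -(mulrA S4) TT -scaleAr scalerA.
by rewrite -natrM.
Qed.

Let RST u : u ^+ 3 = 1 -> R * (S4 * T3 u) = u ^+ 2 *: (S4 * T3 u).
Proof.
move=> u3; have u4 : u ^+ 2 * u ^+ 2 = u by rewrite -exprD exprS u3 mulr1.
rewrite mulrA RS -mulrA scaleAr; congr (_ * _).
rewrite /T3 !mulrDr mulr1 -!scaleAr RRR !scalerDr !scalerA -exprSr u3 scale1r.
by rewrite u4 [LHS](ACl (3*1*2)).
Qed.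

Let trJ (X Y Z : 'M[F]_d) : Z * X = 1 -> \tr (X * Y * Z) = \tr Y.
Proof.
move=> ZX; rewrite (mxtrace_mulC (X * Y) Z : \tr (X * Y * Z) = \tr (Z * (X * Y))).
by rewrite mulrA ZX mul1r.
Qed.

Let trB : \tr B = \tr A.
Proof.
by rewrite -(trJ A (X := R) (Z := R * R)) -?mulrA // (mulrA R A) RA -mulrA RRR mulr1.
Qed.

Let trAB : \tr (A * B) = \tr A.
Proof.
rewrite -trB -(trJ B (X := R) (Z := R * R)) -?mulrA // (mulrA R B) RB.
by rewrite -!mulrA RRR mulr1.
Qed.

(* For k nonzero modulo 3, the coset of R^k modulo the Klein group consists of
   conjugates of R^k under the Klein group, so the trace is constant on it. *)
Let trVR : [/\ \tr (A * R) = \tr R, \tr (B * R) = \tr R & \tr (A * B * R) = \tr R].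
Proof.
split.
- by rewrite -[RHS](trJ R BB) -mulrA RB !mulrA BA -(mulrA A B B) BB mulr1.
- rewrite -[RHS](trJ R AB_conj) -!mulrA RAB !mulrA -(mulrA A B A) BA.
  by rewrite !mulrA AA mul1r.
- by rewrite -[RHS](trJ R AA) -!mulrA RA.
Qed.

Let trVRR : [/\ \tr (A * (R * R)) = \tr (R * R), \tr (B * (R * R)) = \tr (R * R)
  & \tr (A * B * (R * R)) = \tr (R * R)].
Proof.
have RRA : R * R * A = A * B * (R * R) by rewrite -mulrA RA mulrA RB !mulrA.
have RRB : R * R * B = A * (R * R) by rewrite -mulrA RB mulrA RAB !mulrA.
have RRAB : R * R * (A * B) = B * (R * R)
  by rewrite mulrA RRA -(mulrA (A * B)) RRB mulrA -(mulrA A B A) BA (mulrA A A) AA mul1r.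
split.
- rewrite -[RHS](trJ (R * R) AB_conj) -(mulrA (A * B)) RRAB !mulrA.
  by rewrite -(mulrA A B B) BB mulr1.
- by rewrite -[RHS](trJ (R * R) AA) -(mulrA A) RRA !mulrA AA mul1r.
- by rewrite -[RHS](trJ (R * R) BB) -(mulrA B) RRB !mulrA BA.
Qed.

Let trST u : \tr (S4 * T3 u) =
  d%:R + 3%:R * \tr A + 4%:R * (u * \tr R + u ^+ 2 * \tr (R * R)).
Proof.
have [t1 t2 t3] := trVR; have [s1 s2 s3] := trVRR.
rewrite /T3 !mulrDr mulr1 -!scaleAr !mxtraceD !mxtraceZ.
rewrite /S4 !mulrDl !mul1r !mxtraceD t1 t2 t3 s1 s2 s3 trB trAB.
have -> : \tr (1 : 'M[F]_d) = d%:R by exact: mxtrace1.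
ring.
Qed.

Let AQ : A * Q4 = Q4.
Proof. by rewrite /Q4 !mulrDr !mulrN mulr1 mulrA AA mul1r [LHS](ACl (2*1*4*3)). Qed.

Let BQ : B * Q4 = - Q4.
Proof.
rewrite /Q4 !mulrDr !mulrN mulr1 mulrA BA BB -mulrA BB mulr1.
by rewrite !opprD !opprK [LHS](ACl (3*4*1*2)).
Qed.

Let QQ : Q4 * Q4 = 4%:R *: Q4.
Proof.
rewrite {1}/Q4; move: Q4 AQ BQ => Q A_Q B_Q.
rewrite !mulrDl !mulNr mul1r -mulrA B_Q mulrN A_Q opprK.
by rewrite -!mulr2n -!mulrSr scaler_nat.
Qed.

Let trQ : \tr Q4 = d%:R - \tr A.
Proof.
rewrite /Q4 !mxtraceD !raddfN /= trB trAB.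
have -> : \tr (1 : 'M[F]_d) = d%:R by exact: mxtrace1.
ring.
Qed.

Let SQ : S4 + (Q4 + R * Q4 * (R * R) + R * R * Q4 * R) = 1 *+ 4.
Proof.
have RXR X Y : R * X = Y * R -> R * X * (R * R) = Y by move=> ->; rewrite -mulrA RRR mulr1.
have RQ : R * Q4 * (R * R) = 1 + B - A * B - A.
  rewrite /Q4 !mulrDr !mulrN !mulrDl !mulNr mulr1 RRR.
  by rewrite (RXR _ _ RA) (RXR _ _ RB) (RXR _ _ RAB).
have -> : R * R * Q4 * R = R * (R * Q4 * (R * R)) * (R * R).
  by rewrite -!mulrA RRR mulr1.
rewrite RQ.
have -> : R * (1 + B - A * B - A) * (R * R) = 1 + A * B - A - B.
  rewrite !mulrDr !mulrN !mulrDl !mulNr mulr1 RRR.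
  by rewrite (RXR _ _ RA) (RXR _ _ RB) (RXR _ _ RAB).
rewrite /S4 /Q4; move: (A * B) => AB; apply/matrixP => i j.
rewrite !mulrS; move: (1 : 'M[F]_d) => I; rewrite !mxE; ring.
Qed.

Let T3_sum : T3 1 + T3 (w ^+ 2) + T3 (w ^+ 4) = 1 *+ 3.
Proof.
have w4 : w ^+ 4 = w by rewrite exprS w3 mulr1.
have w4' : (w ^+ 2) ^+ 2 = w by rewrite -exprM.
rewrite /T3 expr1n w4 w4'.
have w2 : w ^+ 2 = - w - 1 by apply/eqP; rewrite -subr_eq0 -w_root; apply/eqP; ring.
move: (R * R) => RR; apply/matrixP => i j; rewrite w2 !mulrS.
move: (1 : 'M[F]_d) => I; rewrite !mxE; ring.
Qed.

(** For [m < 3] this is the isotypic projector of a character of degree one.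
    For [m = 3] it is the sum of the conjugates of [Q4 / 4] by the powers of
    [R], which project onto the three nontrivial eigenspaces of the Klein
    group; [R] permutes these eigenspaces. *)
Definition a4_projector (m : nat) : 'M[F]_d :=
  if m is 3 then
    4%:R^-1 *: (Q4 + R * Q4 * (R * R) + R * R * Q4 * R)
  else 12%:R^-1 *: (S4 * T3 (w ^+ (2 * m))).

Lemma a4_projector_sum : \sum_(m < 4) a4_projector m = 1%:M.
Proof.
have n0 n : (n.+1%:R : F) != 0 by rewrite pnatr_eq0.
rewrite !big_ord_recl big_ord0 addr0 /= muln0 expr0 muln1.
rewrite !addrA -!scalerDr -!mulrDr T3_sum mulrnAr mulr1.
rewrite -(scaler_nat 3 S4) scalerA.
have -> : 12%:R^-1 * 3%:R = 4%:R^-1 :> F by field.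
rewrite -!scalerDr SQ -(scaler_nat 4 (1 : 'M[F]_d)) scalerA mulVf ?n0 // scale1r //.
Qed.

Definition a4_word_mx := a4_word mulmx 1%:M A B R.

Lemma a4_projector_linear m p : (m < 3)%N ->
  12%:R * p%:R = d%:R + 3%:R * \tr A +
    4%:R * (w ^+ (2 * m) * \tr R + w ^+ m * \tr (R *m R)) ->
  exists (C : 'I_p -> 'M[F]_(d, 1)) (D : 'I_p -> 'M[F]_(1, d)),
    \sum_j C j *m D j = a4_projector m /\
    forall j x, a4_word_mx x *m C j = C j *m (w ^+ (m * x.2))%:M.
Proof.
move=> m3 trp; set u := w ^+ (2 * m).
have u3 : u ^+ 3 = 1 by rewrite /u -exprM mulnC exprM w3 expr1n.
have u2 : u ^+ 2 = w ^+ m.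
  by rewrite /u -exprM mulnAC -[(2 * 2)%N]/(3 + 1)%N mulnDl exprD exprM w3 expr1n mul1r mul1n.
have projE : a4_projector m = 12%:R^-1 *: (S4 * T3 u).
  by rewrite /a4_projector; case: m m3 @u {trp u3 u2} => [|[|[|m]]].
have n0 n : (n.+1%:R : F) != 0 by rewrite pnatr_eq0.
have [||C [D [CD PC]]] := @trace_idempotent_factor F d (a4_projector m) p.
- rewrite projE -[_ *m _]/(_ * _) -scaleAl -scaleAr ST_idem // !scalerA.
  by rewrite mulfVK.
- rewrite projE mxtraceZ trST u2 -trp mulKf //.
have AC : A *m C = C.
  by rewrite -PC mulmxA projE -scalemxAr -[A *m _]/(A * _) mulrA AS.
have BC : B *m C = C.
  by rewrite -PC mulmxA projE -scalemxAr -[B *m _]/(B * _) mulrA BS.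
have RC : R *m C = w ^+ m *: C.
  rewrite -{1}PC mulmxA projE -scalemxAr -[R *m _]/(R * _) RST // u2.
  by rewrite scalerA mulrC -scalerA -scalemxAl -projE PC.
exists (fun j => col j C), (fun j => row j D); split.
  by rewrite mulmx_sum_col_row.
move=> j [[a b] k].
have -> : (w ^+ (m * k))%:M = a4_word mulmx 1%:M 1%:M 1%:M (w ^+ m)%:M ((a, b), k) :> 'M[F]_1.
  rewrite /a4_word /klein_word /= !if_same !mul1mx exprM.
  elim: (k : nat) => [|i IH] //=.
  by rewrite -IH -scalar_mxM exprS.
by apply: a4_word_intertwine; rewrite ?mul_mx_scalar ?scale1r colE mulmxA ?AC ?BC ?RC
  ?scalemxAl.
Qed.

(** If [A c = c] and [B c = - c] then [c], [R c], [R^2 c] are permuted and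
    multiplied by signs exactly as the coordinate vectors in the representation
    of degree three.  Letting [c] run over a basis of the image of [Q4 / 4]
    exhausts the image of the projector. *)
Lemma a4_projector_cubic p : 4%:R * p%:R = d%:R - \tr A ->
  exists (C : 'I_p -> 'M[F]_(d, 3)) (D : 'I_p -> 'M[F]_(3, d)),
    \sum_j C j *m D j = a4_projector 3 /\
    forall j x, a4_word_mx x *m C j = C j *m a4irr3 x.
Proof.
move=> trp; have n0 n : (n.+1%:R : F) != 0 by rewrite pnatr_eq0.
have [||C [D [CD PC]]] := @trace_idempotent_factor F d (4%:R^-1 *: Q4) p.
- by rewrite -[_ *m _]/(_ * _) -scaleAl -scaleAr QQ // !scalerA mulfVK.
- by rewrite mxtraceZ trQ -trp mulKf.
have AC : A *m C = C by rewrite -PC mulmxA -scalemxAr -[A *m _]/(A * _) AQ.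
have BC : B *m C = - C.
  by rewrite -PC mulmxA -scalemxAr -[B *m _]/(B * _) BQ scalerN mulNmx.
pose c j := col j C; pose r j := row j D.
exists (fun j => cols3 (c j) (R *m c j) (R *m R *m c j)).
exists (fun j => \matrix_(k < 3, l < d) nth (r j *m R) [:: r j; r j *m (R *m R)] k 0 l).
split.
  transitivity (\sum_j (c j *m r j + R *m (c j *m r j) *m (R *m R) +
                        R *m R *m (c j *m r j) *m R)).
    by apply: eq_bigr => j _; rewrite mul_cols3_tr !mulmxA.
  rewrite !big_split /= -!mulmx_suml -!mulmx_sumr mulmx_sum_col_row CD.
  rewrite -!scalemxAr -!scalemxAl -!scalerDr //.
move=> j; have Ac : A *m c j = c j by rewrite /c colE mulmxA AC.
have Bc : B *m c j = - c j by rewrite /c colE mulmxA BC mulNmx.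
have RRA : A *m (R *m c j) = - (R *m c j).
  have e : R *m A *m B = A *m R by rewrite -mulmxA; exact: RAB.
  by rewrite mulmxA -e -!mulmxA Bc !mulmxN Ac.
have RRB : B *m (R *m c j) = R *m c j.
  by rewrite mulmxA [B *m R](esym RA) -mulmxA Ac.
have RRRA : A *m (R *m R *m c j) = - (R *m R *m c j).
  have e : R *m A *m B = A *m R by rewrite -mulmxA; exact: RAB.
  by rewrite !mulmxA -e -!mulmxA RRB RRA mulmxN.
have RRRB : B *m (R *m R *m c j) = - (R *m R *m c j).
  by rewrite !mulmxA [B *m R](esym RA) -!mulmxA RRA mulmxN.
apply: a4_word_intertwine; rewrite mul_mx_cols3.
- by rewrite mul_cols3_half_turn0 Ac RRA RRRA.
- by rewrite mul_cols3_half_turn1 Bc RRB RRRB.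
- rewrite mul_cols3_axes_cycle !mulmxA [R *m R *m R](_ : _ = 1%:M) ?mul1mx //.
  by rewrite -mulmxA; exact: RRR.
Qed.

(** The hypotheses say that [p] is the vector of the scalar products of the
    character of [A], [B], [R] with the irreducible characters.  In the
    conclusion the blocks [C] put together form an invertible matrix, with
    inverse formed by the blocks [D], which conjugates the representation to a
    block diagonal one. *)
Theorem a4_mx_decomposition (p : 'I_4 -> nat) :
  12%:R * (p 0)%:R = d%:R + 3%:R * \tr A + 4%:R * (\tr R + \tr (R *m R)) ->
  12%:R * (p 1)%:R = d%:R + 3%:R * \tr A +
    4%:R * (w ^+ 2 * \tr R + w * \tr (R *m R)) ->
  12%:R * (p 2%:R)%:R = d%:R + 3%:R * \tr A +
    4%:R * (w * \tr R + w ^+ 2 * \tr (R *m R)) ->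
  4%:R * (p 3%:R)%:R = d%:R - \tr A ->
  exists (C : forall i, 'I_(p i) -> 'M[F]_(d, a4irr_deg i))
         (D : forall i, 'I_(p i) -> 'M[F]_(a4irr_deg i, d)),
    \sum_i \sum_j C i j *m D i j = 1%:M /\
    forall i j x, a4_word_mx x *m C i j = C i j *m a4irr w i x.
Proof.
move=> p0 p1 p2 p3.
have block (i : 'I_4) : exists CD : ('I_(p i) -> 'M[F]_(d, a4irr_deg i)) *
    ('I_(p i) -> 'M[F]_(a4irr_deg i, d)),
    \sum_j CD.1 j *m CD.2 j = a4_projector i /\
    forall j x, a4_word_mx x *m CD.1 j = CD.1 j *m a4irr w i x.
  case: i => [[|[|[|[|i]]]] lt_i] //.
  - have -> : Ordinal lt_i = 0 by apply: val_inj.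
    have [//||C [D CD]] := @a4_projector_linear 0 (p 0); last by exists (C, D).
    by rewrite p0 !expr0 !mul1r.
  - have -> : Ordinal lt_i = 1 by apply: val_inj.
    have [//||C [D CD]] := @a4_projector_linear 1 (p 1); last by exists (C, D).
    by rewrite p1 expr1.
  - have -> : Ordinal lt_i = 2%:R by apply: val_inj.
    have [//||C [D CD]] := @a4_projector_linear 2 (p 2%:R); last by exists (C, D).
    by rewrite p2 [w ^+ (2 * 2)]exprS w3 mulr1.
  - have -> : Ordinal lt_i = 3%:R by apply: val_inj.
    by have [C [D CD]] := @a4_projector_cubic (p 3%:R) p3; exists (C, D).
exists (fun i => (sval (cid (block i))).1), (fun i => (sval (cid (block i))).2).
split.
  rewrite -a4_projector_sum; apply: eq_bigr => i _.
  by case: (cid (block i)) => /= CD [].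
by move=> i; case: (cid (block i)) => /= CD [].
Qed.

End Decomposition.

End A4Matrices.

(** * Multiplicities in a group of maps isomorphic to A4 *)

Section A4MapGroups.
Local Open Scope classical_set_scope.
Local Open Scope ring_scope.
Local Open Scope complex_scope.

Section RootOfUnity.
Context {R : realType}.
Local Notation w := (@w R).

Lemma cis_cube (t : R) : (cos t +i* sin t) ^+ 3 = cos (t + t + t) +i* sin (t + t + t).
Proof.
have cisM (s u : R) : (cos s +i* sin s) * (cos u +i* sin u) = cos (s + u) +i* sin (s + u).
  by rewrite cosD sinD; apply/eqP; rewrite eq_complex /= eqxx addrC eqxx.
by rewrite !exprSr expr0 mul1r !cisM.
Qed.

Lemma w_root : w ^+ 2 + w + 1 = 0.
Proof.
have w3 : w ^+ 3 = 1.
  rewrite /w cis_cube (_ : _ + _ + _ = pi + pi); last by field.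
  by rewrite cosD sinD cospi sinpi; apply/eqP; rewrite eq_complex /=;
    apply/andP; split; apply/eqP; ring.
have w1 : w - 1 != 0.
  rewrite subr_eq0; apply/eqP => -[_ sin0].
  have pi0 := @pi_gt0 R.
  have : 0 < sin (2 * pi / 3 : R).
    by apply: sin_gt0_pi; rewrite divr_gt0 ?mulr_gt0 //= ltr_pdivrMr // mulrC ltr_pM2l // ltr_nat.
  by rewrite sin0 ltxx.
apply: (mulfI w1); rewrite mulr0; transitivity (w ^+ 3 - 1); first ring.
by rewrite w3 subrr.
Qed.

Lemma w_cube : w ^+ 3 = 1. Proof. exact: root_cube w_root. Qed.

End RootOfUnity.

Section IrreducibleReps.
Context {F : fieldType}.

Lemma mxtrace_a4irr3 x :
  \tr (@a4irr3 F x) = if x.2 == 0 then if x.1 == (false, false) then 3%:R else -1 else 0.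
Proof.
case: x => u k; rewrite /a4irr3 /a4_word /klein_word /=.
elim/Z3_ind: k; case: u => [[] []] /=; rewrite ?mulmx1 ?mul1mx -?mulmxA;
rewrite /mxtrace !big_ord_recl big_ord0 ?mul_diag_mx.
all: rewrite !mxE /= ?big_ord_recl ?big_ord0 ?mxE /=; ring.
Qed.

Lemma mxtrace_a4irr_linear (w : F) m x : (m < 3)%N ->
  \tr (a4irr w m x) = w ^+ (m * x.2).
Proof. by case: m => [|[|[|m]]] // _; rewrite /= mxtrace_scalar. Qed.

Lemma sub_cV1 (W : {vspace 'cV[F]_1}) : W = 0%VS \/ W = fullv.
Proof.
have [->|W0] := eqVneq W 0%VS; [by left|right].
apply/eqP; rewrite eqEdim subvf dimvf /= /dim /= muln1.
by rewrite lt0n dimv_eq0.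
Qed.

(** The sum of [v] and of its image under the half turn about an axis is twice
    the component of [v] along that axis.  Hence a nonzero stable subspace
    contains a coordinate vector, and then all of them because the elements of
    order three permute the axes. *)
Lemma a4irr3_irreducible (W : {vspace 'cV[F]_3}) : (2%:R : F) != 0 ->
  (forall x v, v \in W -> a4irr3 x *m v \in W) -> W = 0%VS \/ W = fullv.
Proof.
move=> two0 Winv.
have [->|W0] := eqVneq W 0%VS; [by left|right].
pose e (i : 'I_3) : 'cV[F]_3 := delta_mx i 0.
have turn0 (v : 'cV[F]_3) : half_turn 0 *m v = a4irr3 ((true, false), 0) *m v.
  by rewrite /a4irr3 /a4_word /klein_word /= !mulmx1.
have turn1 (v : 'cV[F]_3) : half_turn 1 *m v = a4irr3 ((false, true), 0) *m v.
  by rewrite /a4irr3 /a4_word /klein_word /= mulmx1 mul1mx.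
have cyc (v : 'cV[F]_3) : axes_cycle *m v = a4irr3 ((false, false), 1) *m v.
  by rewrite /a4irr3 /a4_word /klein_word /= !mul1mx mulmx1.
have e_cyc i : e i \in W -> e (i + 1) \in W.
  move=> /(Winv ((false, false), 1)); rewrite -cyc -colE.
  congr (_ \in W); apply/matrixP => k l; rewrite !mxE ord1 eqxx andbT.
  by case: i k => [[|[|[|i]]] lt_i] [[|[|[|k]]] lt_k].
have e_all i : e i \in W -> forall j, e j \in W.
  move=> ei j; rewrite -[j](subrK i) addrC; elim/Z3_ind: (j - i : 'Z_3).
  - by rewrite addr0.
  - exact: e_cyc.
  - by rewrite (_ : -1 = 1 + 1 :> 'Z_3) ?addrA; [exact: (e_cyc _ (e_cyc _ ei)) | apply: val_inj].
pose v := vpick W; have vW : v \in W := memv_pick W.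
have [i vi0] : exists i, v i 0 != 0.
  apply/existsP; rewrite -negb_forall; apply/negP => /forallP v0.
  move: W0; rewrite -vpick0 => /eqP[]; apply/matrixP => i j.
  by rewrite ord1 mxE; apply/eqP.
have coordW j : v j 0 *: e j \in W.
  have [x vx] : exists x, v + a4irr3 x *m v = 2%:R *: (v j 0 *: e j).
    have half_turnE k : v + half_turn k *m v = 2%:R *: (v k 0 *: e k).
      apply/matrixP => l l'; rewrite ord1 mul_diag_mx !mxE eqxx andbT.
      by have [->|] := eqVneq l k; rewrite ?mulr1 ?mul1r ?mulN1r ?subrr ?mulr0 //; ring.
    case: j => [[|[|[|j]]] lt_j] //.
    - by exists ((true, false), 0); rewrite -turn0 (_ : Ordinal _ = 0) //; apply: val_inj.
    - by exists ((false, true), 0); rewrite -turn1 (_ : Ordinal _ = 1) //; apply: val_inj.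
    - exists ((true, true), 0); rewrite /a4irr3 /a4_word /klein_word /= mulmx1.
      rewrite -[RHS](half_turnE (Ordinal lt_j)); congr (_ + _ *m _).
      apply/matrixP => k l; rewrite mul_diag_mx !mxE.
      by case: k l => [[|[|[|k]]] lt_k] [[|[|[|l]]] lt_l] //=;
        rewrite ?mulr0n ?mulr1n; ring.
  rewrite -[_ *: e j]scale1r -(mulVf two0) -scalerA -vx memvZ // memvD //.
  exact: Winv.
have eW j : e j \in W.
  apply: (e_all i); rewrite -[e i]scale1r -(mulVf vi0) -scalerA.
  by rewrite memvZ.
apply/eqP; rewrite eqEsubv subvf; apply/subvP => u _.
have -> : u = \sum_j u j 0 *: e j.
  apply/matrixP => k l; rewrite ord1 summxE (bigD1 k) //= !mxE !eqxx mulr1.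
  rewrite big1 ?addr0 // => j jk; rewrite !mxE eq_sym (negPf jk) mulr0 //.
by apply: memv_suml => j _; rewrite memvZ.
Qed.

End IrreducibleReps.

Section A4MapGroup.
Context {R : realType} {d : nat} {V : Type} {H : set (V -> V)}.
Local Notation C := R[i].
Context {rho : (V -> V) -> 'M[C]_d}.
Local Notation w := (@w R).
Context {a b r : V -> V}.
Context (rel : a4_relations (@comp V V V) id a b r) (a1 : a <> id).
Local Notation e := (a4_word (@comp V V V) id a b r).
Context (He : H = range e) (repX : is_rep H rho).
Local Notation XA := (rho a).
Local Notation XB := (rho b).
Local Notation XR := (rho r).

(** This is [multiplicity_vector] for an arbitrary representation of an
    arbitrary group of maps. *)
Definition a4_multiplicities (K3 K4 : set (V -> V)) (p1 p2 p3 p4 : nat) : Prop :=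
  exists (deg : 'I_4 -> nat) (X : forall i, (V -> V) -> 'M[C]_(deg i)),
    (forall i, is_irreducible_rep H (X i) /\
       forall k g, tnth [tuple [set id]; order_two H; K3; K4] k g ->
         \tr (X i g) = chi i k) /\
    rep_equiv H rho
      (fun g => \mxdiag_(i < 4)
                  \mxdiag_(_ < tnth [tuple p1; p2; p3; p4] i) X i g).

Let e_inj : injective e := a4_word_inj rel a1.
Let eM x y : e x \o e y = e (a4_mul x y) := a4_wordM rel x y.
Let e1 : e a4_one = id := a4_word1 rel.

Let in_H x : H (e x).
Proof. by rewrite He; exists x. Qed.

Let aE : a = e ((true, false), 0). Proof. by []. Qed.
Let bE : b = e ((false, true), 0). Proof. by []. Qed.
Let rE : r = e ((false, false), 1). Proof. by []. Qed.
Let Ha : H a. Proof. by rewrite aE. Qed.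
Let Hb : H b. Proof. by rewrite bE. Qed.
Let Hr : H r. Proof. by rewrite rE. Qed.

Lemma rep_a4_relations : a4_relations mulmx 1%:M XA XB XR.
Proof.
have [X1 XM] := repX.
have XMr f g : H f -> H g -> rho f *m rho g = rho (f \o g).
  by move=> Hf Hg; rewrite XM.
have Hab : H (a \o b) by rewrite aE bE eM.
have Hrr : H (r \o r) by rewrite rE eM.
split; [exact: mulmxA | exact: mul1mx | exact: mulmx1 | | | | | |].
- by rewrite XMr // [a \o a](a4r_aa rel).
- by rewrite XMr // [b \o b](a4r_bb rel).
- by rewrite !XMr // [b \o a](a4r_ba rel).
- by rewrite !XMr // [r \o _](a4r_rrr rel).
- by rewrite !XMr // [r \o a](a4r_ra rel).
- by rewrite !XMr // [r \o b](a4r_rb rel).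
Qed.

Lemma rep_a4_word x : rho (e x) = a4_word mulmx 1%:M XA XB XR x.
Proof.
have [X1 XM] := repX.
have Hpw k : H (iter k (comp r) id) /\
    rho (iter k (comp r) id) = iter k (mulmx XR) 1%:M.
  elim: k => [|k [IH1 IH2]] /=; first by rewrite -e1.
  split; last by rewrite XM // IH2.
  by move: IH1; rewrite He => -[y _ <-]; rewrite rE eM; exists (a4_mul ((false, false), 1) y).
case: x => [[u v] k]; rewrite /a4_word /klein_word /=.
have [Hk XkE] := Hpw k.
have HuA : H (if u then a else id) by case: u => //; rewrite -e1.
have HvB : H (if v then b else id) by case: v => //; rewrite -e1.
have HAB : H ((if u then a else id) \o (if v then b else id)).
  by move: HuA HvB; rewrite He => -[y _ <-] [z _ <-]; rewrite eM; exists (a4_mul y z).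
rewrite (XM _ _ HAB Hk) XkE (XM _ _ HuA HvB); congr (_ *m _ *m _).
  by case: (u); rewrite ?X1.
by case: (v); rewrite ?X1.
Qed.

Lemma conj_class_a4 x g : conj_class H (e x) g ->
  exists y z, g = e y /\ a4_mul z x = a4_mul y z.
Proof.
case; rewrite {1}He => -[y _ <-] [h]; rewrite {1}He => -[z _ <-] zx.
by exists y, z; split=> //; apply: e_inj; rewrite -!eM.
Qed.

(** The exponent [j], which is 1 or -1, selects which class of elements of order
    three is called K3; the character of [r] with value [w] at K3 has value
    [w ^+ j] at [r]. *)
Lemma a4_multiplicities_of_traces (j : 'Z_3) p1 p2 p3 p4 : j != 0 ->
  12%:R * p1%:R = d%:R + 3%:R * \tr XA + 4%:R * (\tr XR + \tr (XR *m XR)) ->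
  12%:R * p2%:R = d%:R + 3%:R * \tr XA +
    4%:R * ((w ^+ j) ^+ 2 * \tr XR + w ^+ j * \tr (XR *m XR)) ->
  12%:R * p3%:R = d%:R + 3%:R * \tr XA +
    4%:R * (w ^+ j * \tr XR + (w ^+ j) ^+ 2 * \tr (XR *m XR)) ->
  4%:R * p4%:R = d%:R - \tr XA ->
  a4_multiplicities (conj_class H (e ((false, false), j)))
    (conj_class H (e ((false, false), - j))) p1 p2 p3 p4.
Proof.
move=> j0 Hp1 Hp2 Hp3 Hp4; set u := w ^+ j.
have w_cube := @w_cube R; have w_root := @w_root R.
have u_root : u ^+ 2 + u + 1 = 0.
  move: j0; rewrite /u; elim/Z3_ind: (j) => // _.
  rewrite -exprM [w ^+ (_ * _)]exprS w_cube mulr1 -[RHS]w_root.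
  by rewrite [w + _]addrC.
have u_cube : u ^+ 3 = 1 by rewrite /u -exprM mulnC exprM w_cube expr1n.
pose einv g := xget a4_one [set x | e x = g].
have einvK x : einv (e x) = x.
  by apply: e_inj; rewrite /einv; case: xgetP => [y _ //|/(_ x)] /=.
exists (fun i => a4irr_deg i), (fun i g => a4irr u i (einv g)); split.
  move=> i; split.
    split; first by case: i => [[|[|[|[|i]]]] lt_i].
      split; first by rewrite -e1 einvK a4irr1.
      by move=> f g; rewrite {1}He => -[x _ <-]; rewrite {1}He => -[y _ <-];
        rewrite eM !einvK a4irrM.
    move=> W Winv.
    have {}Winv x v : v \in W -> a4irr u i x *m v \in W.
      by move=> vW; have := Winv (e x) v (in_H x) vW; rewrite einvK.
    case: i W Winv => [[|[|[|[|i]]]] lt_i] //= W Winv; try exact: sub_cV1.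
    by apply: a4irr3_irreducible => //; rewrite pnatr_eq0.
  have trE x : \tr (a4irr u i x) = if (i < 3)%N then u ^+ (i * x.2)
      else if x.2 == 0 then if x.1 == (false, false) then 3%:R else -1 else 0.
    case: i => [[|[|[|[|i]]]] lt_i] //;
      by [rewrite mxtrace_a4irr_linear | rewrite -mxtrace_a4irr3].
  have uj : u ^+ j = w.
    move: j0; rewrite /u; elim/Z3_ind: (j) => // _.
    by rewrite -exprM [w ^+ _]exprS w_cube mulr1.
  have uNj : u ^+ (- j) = w ^+ 2.
    by move: j0; rewrite /u; elim/Z3_ind: (j) => // _; rewrite -?exprM //.
  case=> [[|[|[|[|k]]]] lt_k] // g; rewrite (tnth_nth set0) /= => gk.
  - have -> : g = e a4_one by rewrite gk e1.
    rewrite einvK trE muln0 expr0 /chi.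
    by case: i {trE} => [[|[|[|[|i]]]] lt_i].
  - case: gk; rewrite {1}He => -[y _ <-]; rewrite eM -e1 => y1 /e_inj yy.
    have y20 : y.2 = 0.
      by move: (congr1 (fun z : a4 => z.2) yy) => /=; elim/Z3_ind: (y.2).
    have y10 : y.1 != (false, false).
      by apply/eqP => y10; apply: y1; rewrite [y]surjective_pairing y10 y20.
    rewrite einvK trE y20 muln0 expr0 eqxx (negPf y10) /chi.
    by case: i {trE} => [[|[|[|[|i]]]] lt_i].
  - have [y [z [-> zy]]] := conj_class_a4 gk.
    have y2 : y.2 = j.
      apply: (@addIr _ z.2); rewrite -[LHS](congr1 (fun z : a4 => z.2) zy).
      exact: addrC.
    rewrite einvK trE y2 mulnC exprM uj (negPf j0) /chi.
    by case: i {trE} => [[|[|[|[|i]]]] lt_i].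
  - have [y [z [-> zy]]] := conj_class_a4 gk.
    have y2 : y.2 = - j.
      apply: (@addIr _ z.2); rewrite -[LHS](congr1 (fun z : a4 => z.2) zy).
      exact: addrC.
    rewrite einvK trE y2 mulnC exprM uNj oppr_eq0 (negPf j0) /chi.
    case: i {trE} => [[|[|[|[|i]]]] lt_i] //=.
    by rewrite -exprM [w ^+ _]exprS w_cube mulr1.
pose p (i : 'I_4) := tnth [tuple p1; p2; p3; p4] i.
have [||||Ci [Di [CD1 Cint]]] := @a4_mx_decomposition C d u u_root XA XB XR
  rep_a4_relations p.
- exact: Hp1.
- exact: Hp2.
- exact: Hp3.
- exact: Hp4.
have dE : d = (\sum_(i < 4) \sum_(k < p i) a4irr_deg i)%N.
  apply/eqP; rewrite -(eqr_nat C) !big_ord_recl big_ord0 /=.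
  rewrite !sum_nat_const !card_ord /= !muln1 addn0 !natrD natrM.
  change (p ord0) with p1; change (p (lift ord0 ord0)) with p2.
  change (p (lift ord0 (lift ord0 ord0))) with p3.
  change (p (lift ord0 (lift ord0 (lift ord0 ord0)))) with p4.
  have n0 : (12%:R : C) != 0 by rewrite pnatr_eq0.
  apply/eqP/(mulfI n0).
  have -> : 12%:R * (p1%:R + (p2%:R + (p3%:R + p4%:R * 3%:R))) =
    12%:R * p1%:R + 12%:R * p2%:R + 12%:R * p3%:R + 9%:R * (4%:R * p4%:R) :> C by ring.
  rewrite Hp1 Hp2 Hp3 Hp4 -/u.
  have -> : u ^+ 2 = - u - 1 by apply/eqP; rewrite -subr_eq0 -u_root; apply/eqP; ring.
  ring.
exists (\mxrow_i \mxrow_j Ci i j); split => //.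
  apply/row_freeP; exists (\mxcol_i \mxcol_j Di i j).
  rewrite mul_mxrow_mxcol -CD1; apply: eq_bigr => i _.
  by rewrite mul_mxrow_mxcol.
move=> g; rewrite {1}He => -[x _ <-].
rewrite rep_a4_word mul_mxrow mul_mxrow_mxdiag.
apply: eq_mxrow => i; rewrite mul_mxrow mul_mxrow_mxdiag.
by apply: eq_mxrow => k; rewrite einvK; exact: Cint.
Qed.

Lemma conj_class_sub z x y : a4_mul z y = a4_mul x z ->
  conj_class H (e x) `<=` conj_class H (e y).
Proof.
move=> zy s [Hs [h Hh hx]]; split=> //.
exists (h \o e z); first by move: Hh; rewrite He => -[t _ <-]; rewrite eM; exists (a4_mul t z).
by rewrite -compA eM zy -eM compA hx.
Qed.

(** Conjugating [r^k] by an element [v] of the Klein group multiplies it by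
    [v + turn^k v], and this takes all values as [v] varies.  So the class of an
    element of order three depends only on its image in the quotient by the
    Klein group. *)
Lemma conj_class_order3 x : x.2 != 0 ->
  conj_class H (e x) = conj_class H (e ((false, false), x.2)).
Proof.
case: x => u k /= k0.
have [v vE] : exists v, v = klein_add u (iter k klein_turn v).
  by move: k0; elim/Z3_ind: k => // _; case: u => [[] []];
    do [by exists (false, false) | by exists (true, false) | by exists (false, true)
      | by exists (true, true)].
have z1 : a4_mul (v, 0) ((false, false), k) = a4_mul (u, k) (v, 0).
  rewrite /a4_mul /= -vE addr0 add0r /klein_add /= !addbF; congr (_, _).
  exact: esym (surjective_pairing v).
have z2 : a4_mul (v, 0) (u, k) = a4_mul ((false, false), k) (v, 0).
  rewrite /a4_mul /= addr0 add0r; congr (_, _); rewrite {1}vE.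
  by move: (iter _ _ _) => t; case: u t {z1 vE} => [[] []] [[] []].
by apply/seteqP; split; [exact: conj_class_sub z1 | exact: conj_class_sub z2].
Qed.

Lemma order3_labelling_a4 K3 K4 : order3_labelling H K3 K4 ->
  exists j : 'Z_3, [/\ j != 0, K3 = conj_class H (e ((false, false), j))
    & K4 = conj_class H (e ((false, false), - j))].
Proof.
case=> K34 [f [g [f3 g3 K3E K4E]]].
have order3_not0 h : order_three H h ->
    exists2 x, x.2 != 0 & conj_class H h = conj_class H (e x).
  case; rewrite {1}He => -[x _ <-] x1 xxx; exists x => //.
  apply/eqP => x20; apply: x1; rewrite -e1; move: xxx; rewrite !eM -e1 => /e_inj.
  rewrite [x]surjective_pairing x20; case: x.1 => u v /=.
  by case: u v => [] [].
have [x x0 fE] := order3_not0 _ f3; have [y y0 gE] := order3_not0 _ g3.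
rewrite K3E K4E fE gE (conj_class_order3 x0) (conj_class_order3 y0).
exists x.2; split=> //; have [xy|xy] := eqVneq y.2 x.2.
  by case: K34; rewrite K3E K4E fE gE (conj_class_order3 x0) (conj_class_order3 y0) xy.
by move: x0 y0 xy; elim/Z3_ind: (x.2); elim/Z3_ind: (y.2).
Qed.

(** When the character takes the same value on both classes of elements of order
    three, exchanging K3 and K4 exchanges two equal multiplicities. *)
Lemma labelled_a4_multiplicities K3 K4 p q s :
  \tr XR = \tr (XR *m XR) ->
  12%:R * p%:R = d%:R + 3%:R * \tr XA + 8%:R * \tr XR ->
  12%:R * q%:R = d%:R + 3%:R * \tr XA - 4%:R * \tr XR ->
  4%:R * s%:R = d%:R - \tr XA ->
  order3_labelling H K3 K4 -> a4_multiplicities K3 K4 p q q s.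
Proof.
move=> tr_eq Hp Hq Hs /order3_labelling_a4[j [j0 -> ->]].
have u_root : (w ^+ j) ^+ 2 = - w ^+ j - 1.
  apply/eqP; rewrite -subr_eq0; apply/eqP; rewrite -[RHS](@w_root R).
  move: j0; elim/Z3_ind: (j) => // _; first by rewrite expr1; ring.
  by rewrite -exprM [w ^+ (_ * _)]exprS (@w_cube R) mulr1; ring.
by apply: a4_multiplicities_of_traces; rewrite -?tr_eq ?Hp ?Hq ?Hs ?u_root //; ring.
Qed.

End A4MapGroup.

End A4MapGroups.

(** * Linear fractional transformations and the maps g_sigma *)

Section Lft.
Local Open Scope classical_set_scope.
Local Open Scope ring_scope.
Local Open Scope complex_scope.
Context {R : realType}.
Local Notation C := R[i].
Local Notation sphere := (@sphere R).
Implicit Types (z : sphere) (p q : C * C) (a b c d k : C).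

(** Homogeneous coordinates treat the point at infinity like any other point: a
    linear fractional transformation becomes a linear map ([mat_act]), and two
    points agree when the determinant of their coordinates ([bracket])
    vanishes. *)
Definition hcoord z : C * C := if z is Some x then (x, 1) else (1, 0).
Definition of_hcoord p : sphere := if p.2 == 0 then None else Some (p.1 / p.2).
Definition bracket p q : C := p.1 * q.2 - p.2 * q.1.
Definition mat_act (a b c d : C) p := (a * p.1 + b * p.2, c * p.1 + d * p.2).
Definition scale_pt (k : C) p := (k * p.1, k * p.2).

Lemma lftE a b c d z : lft a b c d z = of_hcoord (mat_act a b c d (hcoord z)).
Proof. by case: z => [z|]; rewrite /of_hcoord /= ?mulr1 ?mulr0 ?addr0. Qed.

Lemma of_hcoord_scale k z : k != 0 -> of_hcoord (scale_pt k (hcoord z)) = z.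
Proof.
move=> k0; case: z => [x|]; rewrite /of_hcoord /= ?mulr0 ?eqxx // mulr1.
by rewrite (negPf k0) mulrC mulKf.
Qed.

Lemma scale_of_hcoord p : p <> (0, 0) ->
  exists2 k, k != 0 & p = scale_pt k (hcoord (of_hcoord p)).
Proof.
case: p => x y p0; rewrite /of_hcoord /=; have [y0|y0] := eqVneq y 0.
  exists x; last by rewrite /scale_pt /= y0 mulr0 mulr1.
  by apply/eqP => x0; apply: p0; rewrite x0 y0.
by exists y; rewrite // /scale_pt /= mulr1 mulrC divfK.
Qed.

Lemma mat_act_eq0 a b c d p : a * d - b * c != 0 -> mat_act a b c d p = (0, 0) -> p = (0, 0).
Proof.
move=> det0 [E1 E2]; apply/eqP; case: p E1 E2 => x y /= E1 E2; apply/andP => /=.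
by split; apply/eqP; apply: (mulfI det0); rewrite mulr0;
  [transitivity (d * (a * x + b * y) - b * (c * x + d * y)) |
   transitivity (a * (c * x + d * y) - c * (a * x + b * y))];
  (try by rewrite E1 E2 !mulr0 subrr); ring.
Qed.

Lemma hcoord_neq0 z : hcoord z <> (0, 0).
Proof. by case: z => [x|] [] => [_|] /eqP; rewrite oner_eq0. Qed.

Lemma mat_act_hcoord a b c d z : a * d - b * c != 0 ->
  exists2 k, k != 0 & mat_act a b c d (hcoord z) = scale_pt k (hcoord (lft a b c d z)).
Proof.
by move=> det0; rewrite lftE; apply: scale_of_hcoord => /(mat_act_eq0 det0)/hcoord_neq0.
Qed.

Lemma lft_eq a b c d k z z' : k != 0 ->
  mat_act a b c d (hcoord z) = scale_pt k (hcoord z') -> lft a b c d z = z'.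
Proof. by move=> k0 E; rewrite lftE E of_hcoord_scale. Qed.

Lemma bracket_hcoord_eq0 z z' : bracket (hcoord z) (hcoord z') = 0 -> z = z'.
Proof.
rewrite /bracket; case: z z' => [x|] [y|] //=; rewrite ?(mulr1, mul1r, mulr0, mul0r) ?subr0 ?sub0r.
- by move=> /subr0_eq->.
- by move=> /eqP; rewrite oppr_eq0 oner_eq0.
- by move=> /eqP; rewrite oner_eq0.
Qed.

Lemma lft_comp a b c d a' b' c' d' : a' * d' - b' * c' != 0 ->
  lft a b c d \o lft a' b' c' d' =
  lft (a * a' + b * c') (a * b' + b * d') (c * a' + d * c') (c * b' + d * d').
Proof.
move=> det0; apply/funext => z /=; have [k k0 E] := mat_act_hcoord z det0.
rewrite [RHS]lftE.
have -> : mat_act (a * a' + b * c') (a * b' + b * d') (c * a' + d * c') (c * b' + d * d') (hcoord z)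
   = mat_act a b c d (mat_act a' b' c' d' (hcoord z)).
  by rewrite /mat_act /=; congr (_, _); ring.
rewrite E lftE /of_hcoord /=.
rewrite !(mulrCA _ k) -!mulrDr mulf_eq0 (negPf k0) /=; case: ifP => // _.
by rewrite -mulf_div divff // mul1r.
Qed.

Lemma lft_scale k a b c d : k != 0 -> lft (k * a) (k * b) (k * c) (k * d) = lft a b c d.
Proof.
move=> k0; apply/funext => z; rewrite !lftE /of_hcoord /=.
rewrite -!mulrA -!mulrDr mulf_eq0 (negPf k0) /=; case: ifP => // _.
by rewrite -mulf_div divff // mul1r.
Qed.

Lemma lft_scalar k : k != 0 -> lft k 0 0 k = id.
Proof.
move=> k0; apply/funext => z; rewrite lftE -[RHS](of_hcoord_scale z k0).
by rewrite /mat_act /scale_pt !mul0r addr0 add0r.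
Qed.

Lemma is_lft_comp f g : @is_lft R f -> is_lft g -> is_lft (f \o g).
Proof.
move=> [a [b [c [d [det0 ->]]]]] [a' [b' [c' [d' [det0' ->]]]]].
rewrite lft_comp //; do 4!eexists; split; last reflexivity.
rewrite [X in X != 0](_ : _ = (a * d - b * c) * (a' * d' - b' * c')); last by ring.
by rewrite mulf_neq0.
Qed.

Lemma is_lft_id : @is_lft R id.
Proof. by exists 1, 0, 0, 1; rewrite lft_scalar ?oner_eq0 // mulr0 mulr1 subr0 oner_eq0. Qed.

Lemma is_lft_inv f : @is_lft R f ->
  exists g, [/\ is_lft g, g \o f = id & f \o g = id].
Proof.
move=> [a [b [c [d [det0 ->]]]]]; exists (lft d (- b) (- c) a).
have det0' : d * a - - b * - c != 0 by rewrite mulrNN mulrC.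
split; first by exists d, (- b), (- c), a.
- rewrite lft_comp // -[RHS](lft_scalar det0); congr lft; ring.
- rewrite lft_comp // -[RHS](lft_scalar det0); congr lft; ring.
Qed.

Lemma is_lft_inj f : @is_lft R f -> injective f.
Proof. by move=> /is_lft_inv[g [_ gf _]] x y /(congr1 g); rewrite -![g _]/((g \o f) _) gf. Qed.

Lemma lft_fix_id f : @is_lft R f -> (forall i, f (zero_one_infty i) = zero_one_infty i) ->
  f = id.
Proof.
move=> [a [b [c [d [det0 ->]]]]] fix3.
have /= := fix3 0; have /= := fix3 1; have /= := fix3 2%:R.
rewrite /zero_one_infty /tnth /= !mulr0 !mulr1 !add0r.
case: eqP => [->|_ //] _; rewrite add0r; case: eqP => [//|/eqP d0] [ad] [bd].
have b0 : b = 0 by rewrite -[b](divfK d0) bd mul0r.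
have da : a = d by move: ad; rewrite b0 addr0 => /(congr1 ( *%R^~ d)); rewrite divfK // mul1r.
by rewrite b0 da lft_scalar.
Qed.

(** By composition with an inverse this reduces to the fact that only the
    identity fixes 0, 1 and infinity. *)
Lemma lft_normalized_uniq f g (z : 'I_3 -> sphere) : is_lft f -> is_lft g ->
  (forall i, f (z i) = zero_one_infty i) -> (forall i, g (z i) = zero_one_infty i) ->
  f = g.
Proof.
move=> lf lg fz gz; have [g' [lg' g'g gg']] := is_lft_inv lg.
have fg'1 : f \o g' = id.
  apply: lft_fix_id; first exact: is_lft_comp.
  by move=> k; rewrite -{1}gz /= -[g' (g _)]/((g' \o g) _) g'g.
transitivity (f \o (g' \o g)); first by rewrite g'g.
by rewrite -[f \o _]/((f \o g') \o g) fg'1.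
Qed.

(** The cross ratio with three given points, which sends them to 0, 1 and
    infinity. *)
Definition normalizing_lft z1 z2 z3 : sphere -> sphere :=
  let p1 := hcoord z1 in let p2 := hcoord z2 in let p3 := hcoord z3 in
  let k := bracket p2 p3 in let l := bracket p2 p1 in
  lft (k * p1.2) (- (k * p1.1)) (l * p3.2) (- (l * p3.1)).

Lemma normalizing_lftE z1 z2 z3 z :
  normalizing_lft z1 z2 z3 z =
  of_hcoord (bracket (hcoord z) (hcoord z1) * bracket (hcoord z2) (hcoord z3),
          bracket (hcoord z) (hcoord z3) * bracket (hcoord z2) (hcoord z1)).
Proof.
rewrite /normalizing_lft lftE /mat_act /=.
by congr (of_hcoord (_, _)); rewrite /bracket; ring.
Qed.

Lemma normalizing_lftP z1 z2 z3 : z1 <> z2 -> z1 <> z3 -> z2 <> z3 ->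
  [/\ is_lft (normalizing_lft z1 z2 z3), normalizing_lft z1 z2 z3 z1 = Some 0,
      normalizing_lft z1 z2 z3 z2 = Some 1 & normalizing_lft z1 z2 z3 z3 = None].
Proof.
move=> z12 z13 z23.
have b0 z z' : z <> z' -> bracket (hcoord z) (hcoord z') != 0.
  by move=> zz'; apply/eqP => /bracket_hcoord_eq0.
have bb z : bracket (hcoord z) (hcoord z) = 0 by rewrite /bracket mulrC subrr.
have b13 := b0 _ _ z13; have b21 := b0 _ _ (not_eq_sym z12); have b23 := b0 _ _ z23.
split.
- do 4!eexists; split; last reflexivity.
  rewrite [X in X != 0](_ : _ = bracket (hcoord z2) (hcoord z3) *
    bracket (hcoord z2) (hcoord z1) * bracket (hcoord z1) (hcoord z3)).
    by rewrite !mulf_neq0.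
  by rewrite /bracket; ring.
- by rewrite normalizing_lftE /of_hcoord /= bb mul0r mulf_eq0 (negPf b13) (negPf b21) mul0r.
- rewrite normalizing_lftE /of_hcoord /= mulf_eq0 (negPf b23) (negPf b21).
  by rewrite [X in X / _]mulrC divff // mulf_neq0.
- by rewrite normalizing_lftE /of_hcoord /= bb mul0r eqxx.
Qed.

End Lft.

Section ConfigurationMaps.
Local Open Scope classical_set_scope.
Local Open Scope ring_scope.
Local Open Scope complex_scope.
Context {R : realType} {d : nat}.
Local Notation C := R[i].
Local Notation V := 'rV[C]_d.
Local Notation sphere := (@sphere R).
Implicit Types (mu : V) (s : {perm 'I_(3 + d)}).

Lemma zpt_lshift mu k : zpt mu (lshift d k) = zero_one_infty k.
Proof. by rewrite /zpt -[lshift d k]/(unsplit (inl k)) unsplitK. Qed.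

Lemma zpt_rshift mu j : zpt mu (rshift 3 j) = Some (mu 0 j).
Proof. by rewrite /zpt -[rshift 3 j]/(unsplit (inr j)) unsplitK. Qed.

Lemma zero_one_infty_inj : injective (@zero_one_infty R).
Proof.
have n1 : (0 : C) <> 1 by move/eqP; rewrite eq_sym oner_eq0.
move=> [[|[|[|i]]] lt_i] [[|[|[|j]]] lt_j] //; try by move=> _; apply: val_inj.
all: rewrite /zero_one_infty /tnth //= => /Some_inj E; by case: n1; rewrite E.
Qed.

(** All the inequalities that define the configuration space say at once that
    the marked points, including 0, 1 and infinity, are pairwise distinct. *)
Lemma KnP mu : Kn mu <-> injective (zpt mu).
Proof.
split=> [[mu01 mu_neq] i j|zinj].
- rewrite -(splitK i) -(splitK j).
  case: (fintype.split i) => k; case: (fintype.split j) => l /=;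
    rewrite ?zpt_lshift ?zpt_rshift.
  + by move=> /zero_one_infty_inj ->.
  + case: (mu01 l) => l0 l1; case: k => [[|[|[|k]]] lt_k] // [E].
    * by rewrite -E eqxx in l0.
    * by rewrite -E eqxx in l1.
  + case: (mu01 k) => l0 l1; case: l => [[|[|[|l]]] lt_l] // [E].
    * by rewrite E eqxx in l0.
    * by rewrite E eqxx in l1.
  + move=> [E]; have [->//|kl] := eqVneq k l.
    by have := mu_neq _ _ kl; rewrite E eqxx.
- have z0 : zpt mu (lshift d 0) = Some 0 by rewrite zpt_lshift.
  have z1 : zpt mu (lshift d 1) = Some 1 by rewrite zpt_lshift.
  split=> [i|i j ij].
    split; apply/eqP => E.
      have := @zinj (rshift 3 i) (lshift d 0).
      by rewrite zpt_rshift z0 E => /(_ erefl)/eqP; rewrite eq_rlshift.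
    have := @zinj (rshift 3 i) (lshift d 1).
    by rewrite zpt_rshift z1 E => /(_ erefl)/eqP; rewrite eq_rlshift.
  apply: contra_neq ij => E.
  by apply: (@rshift_inj 3 d); apply: zinj; rewrite !zpt_rshift E.
Qed.

Section Base.
Context {mu : V} (mu_Kn : Kn mu).
Let zinj := (KnP mu).1 mu_Kn.

Lemma zpt_perm_neq s i j : i != j -> zpt mu (s i) <> zpt mu (s j).
Proof. by move=> /eqP ij /zinj/perm_inj. Qed.

Lemma normalizing_lft_perm s :
  let f := normalizing_lft (zpt mu (s (lshift d 0))) (zpt mu (s (lshift d 1)))
    (zpt mu (s (lshift d 2%:R))) in
  is_lft f /\ forall k : 'I_3, f (zpt mu (s (lshift d k))) = zero_one_infty k.
Proof.
have ne k l : k != l -> zpt mu (s (lshift d k)) <> zpt mu (s (lshift d l)).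
  by move=> kl; apply: zpt_perm_neq; rewrite (inj_eq (@lshift_inj _ _)).
move=> f; have [lf f0 f1 f2] := normalizing_lftP (ne 0 1 isT) (ne 0 2%:R isT) (ne 1 2%:R isT).
split=> // -[[|[|[|k]]] lt_k] //.
- by rewrite (_ : Ordinal lt_k = 0) //; apply: val_inj.
- by rewrite (_ : Ordinal lt_k = 1) //; apply: val_inj.
- by rewrite (_ : Ordinal lt_k = 2%:R) //; apply: val_inj.
Qed.

Lemma f_P s : is_lft (f_ s mu) /\
  forall k, f_ s mu (zpt mu ((s^-1)%g (lshift d k))) = zero_one_infty k.
Proof.
rewrite /f_; case: xgetP => [f _ //|/(_ _ (normalizing_lft_perm s^-1)) []].
Qed.

Lemma f_uniq s f : is_lft f ->
  (forall k, f (zpt mu ((s^-1)%g (lshift d k))) = zero_one_infty k) -> f_ s mu = f.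
Proof. by move=> lf fz; have [lg gz] := f_P s; exact: lft_normalized_uniq gz fz. Qed.

(** The transformation [f_] carries the relabelled marked points to the marked
    points of the image under [g_]: the first three by normalization, the others
    by definition of [g_]. *)
Lemma g_zpt s i : zpt (g_ s mu) i = f_ s mu (zpt mu ((s^-1)%g i)).
Proof.
have [lf fz] := f_P s; rewrite -(splitK i); case: (fintype.split i) => k /=.
  by rewrite fz zpt_lshift.
rewrite zpt_rshift /g_ mem_set // mxE.
case E: (f_ s mu _) => [x|] //=.
have f2 : f_ s mu (zpt mu ((s^-1)%g (lshift d 2%:R))) = None by rewrite fz.
by move: E; rewrite -f2 => /(is_lft_inj lf)/zinj/perm_inj/eqP; rewrite eq_rlshift.
Qed.

Lemma g_Kn s : Kn (g_ s mu).
Proof.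
have [lf _] := f_P s; apply/KnP => i j; rewrite !g_zpt.
by move=> /(is_lft_inj lf)/zinj/perm_inj.
Qed.

End Base.

Lemma zpt_eq mu nu : zpt mu =1 zpt nu -> mu = nu.
Proof.
move=> E; apply/rowP => j; have := E (rshift 3 j).
by rewrite !zpt_rshift => -[].
Qed.

(** The composite of the two normalizing transformations is normalizing for the
    product permutation.  Permutations multiply from left to right, whence the
    order of the factors. *)
Lemma g_comp p s : g_ p \o g_ s = @g_ R d (s * p)%g.
Proof.
apply/funext => mu /=; have [mu_in|mu_out] := boolP (mu \in Kn); last first.
  by rewrite /g_ (negPf mu_out) (negPf mu_out).
have muK : Kn mu by rewrite inE in mu_in.
have gK := g_Kn muK s.
have fE : f_ (s * p)%g mu = f_ p (g_ s mu) \o f_ s mu.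
  have [lf _] := f_P muK s; have [lf' fz'] := f_P gK p.
  apply: f_uniq => //; first exact: is_lft_comp.
  by move=> k; rewrite -fz' g_zpt //= invMg permM.
by apply: zpt_eq => i; rewrite !g_zpt // fE /= invMg permM.
Qed.

Lemma g_1 : @g_ R d 1%g = id.
Proof.
apply/funext => mu; have [mu_in|mu_out] := boolP (mu \in Kn); last first.
  by rewrite /g_ (negPf mu_out).
have muK : Kn mu by rewrite inE in mu_in.
apply: zpt_eq => i; rewrite g_zpt //.
rewrite (f_uniq muK (@is_lft_id R)) /= ?invg1 ?perm1 // => k.
by rewrite perm1 zpt_lshift.
Qed.

End ConfigurationMaps.

(** * Differentials of cross ratios *)

Section NearDifferentiable.
Local Open Scope classical_set_scope.
Local Open Scope ring_scope.

(** Needed because [g_] is given by rational functions only on the open set of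
    configurations. *)
Lemma near_eq_differentiable (K : numFieldType) (V W : normedModType K)
    (f g : V -> W) (x : V) :
  (\near x, f x = g x) -> differentiable f x -> differentiable g x.
Proof.
move=> fg df; have [cf] := (diff_locallyP _ _).1 df.
move=> /eqaddoP Ef.
have Eg : g \o shift x = cst (g x) + 'd f x +o_ 0 id.
  apply/eqaddoP => e e0; have := Ef e e0.
  have fgx : f x = g x by exact: nbhs_singleton fg.
  have fg0 : \forall h \near (0 : V), f (h + x) = g (h + x).
    by move: fg; rewrite (near_shift 0 x) /=; apply: filterS => h; rewrite subr0.
  move: fg0; apply: filterS2 => h fgh.
  by rewrite /= -![(_ + _) h]/(_ h + _ h) -![(- _) h]/(- _ h) /= fgh fgx.
have dE : 'd g x = 'd f x :> (V -> W) by exact: diff_unique.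
by apply/diff_locallyP; rewrite dE.
Qed.

Lemma jacobian_entry (K : numFieldType) m n (f : 'rV[K]_m -> 'rV[K]_n) p i j :
  differentiable f p ->
  jacobian f p i j = 'D_(delta_mx 0 i) (fun q => f q 0 j) p.
Proof.
move=> df; rewrite deriveE; last first.
  exact: (differentiable_comp df (differentiable_coord _ 0 j)).
rewrite (diff_comp df (differentiable_coord _ 0 j)) /=.
have @cj : {linear 'rV[K]_n -> K}.
  by exists (fun N : 'rV[K]_n => N 0 j); do 2![eexists]; do ?[constructor];
     rewrite ?mxE// => ? *; rewrite ?mxE//; move=> ?; rewrite !mxE.
rewrite (_ : (fun N : 'rV[K]_n => N 0 j) = cj) // diff_lin; last exact: coord_continuous.
by rewrite /jacobian /lin1_mx mxE.
Qed.

Lemma differentiable_row (K : numFieldType) (V : normedModType K) n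
    (F : 'I_n -> V -> K) p :
  (forall j, differentiable (F j) p) ->
  differentiable (fun q => \row_j F j q) p.
Proof.
move=> dF; rewrite (_ : (fun q => _) = \sum_j (fun q => F j q *: delta_mx 0 j)).
  by apply: differentiable_sum => j; exact: differentiableZl.
apply/funext => q; rewrite fct_sumE; apply/rowP => k; rewrite mxE summxE (bigD1 k) //=.
rewrite big1 ?addr0 ?mxE ?eqxx ?mulr1 // => j jk.
by rewrite !mxE eqxx (eq_sym k) (negPf jk) mulr0.
Qed.

Lemma is_deriveV (K : numFieldType) (V : normedModType K) (f : V -> K) (x v : V) df :
  f x != 0 -> is_derive x v f df -> is_derive x v (fun y => (f y)^-1) (- (f x) ^- 2 *: df).
Proof.
move=> fx0 [df1 df2]; split; first exact: derivableV.
by rewrite deriveV // df2.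
Qed.

End NearDifferentiable.

Section CrossRatio.
Local Open Scope ring_scope.
Context {K : numFieldType} {V : normedModType K}.

Definition cross_ratio (p q0 q1 q2 : K * K) : K :=
  ((p.1 * q0.2 - p.2 * q0.1) * (q1.1 * q2.2 - q1.2 * q2.1)) /
  ((p.1 * q2.2 - p.2 * q2.1) * (q1.1 * q0.2 - q1.2 * q0.1)).

(** The points indexed by 0, 1, 2 are the reference points of the cross ratio,
    and start at 0, 1 and infinity; the one indexed by 3 moves and starts at
    [z].  The derivative is the displacement of the moving point minus the value
    at [z] of the quadratic vector field which interpolates the displacements of
    the reference points: moving all points along the flow of such a field does
    not change the cross ratio. *)
Lemma is_derive_cross_ratio (x v : V) (X Y : 'I_4 -> V -> K) (dX dY : 'I_4 -> K) z :
  (forall i, is_derive x v (X i) (dX i)) -> (forall i, is_derive x v (Y i) (dY i)) ->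
  [/\ X 0 x = 0, X 1 x = 1, X 2%:R x = 1 & X 3%:R x = z] ->
  [/\ Y 0 x = 1, Y 1 x = 1, Y 2%:R x = 0 & Y 3%:R x = 1] ->
  is_derive x v
    (fun y => cross_ratio (X 3%:R y, Y 3%:R y) (X 0 y, Y 0 y) (X 1 y, Y 1 y) (X 2%:R y, Y 2%:R y))
    ((dX 3%:R - z * dY 3%:R) - (1 - z) * dX 0 - z * (dX 1 - dY 1) + z * (z - 1) * dY 2%:R).
Proof.
move=> hX hY [X0 X1 X2 X3] [Y0 Y1 Y2 Y3].
have br i j : is_derive x v (fun y => X i y * Y j y - Y i y * X j y)
  (X i x * dY j + Y j x * dX i - (Y i x * dX j + X j x * dY i)).
  exact: is_derive_eq (is_deriveB (is_deriveM (hX i) (hY j)) (is_deriveM (hY i) (hX j))) _.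
pose D := fun y => (X 3%:R y * Y 2%:R y - Y 3%:R y * X 2%:R y) * (X 1 y * Y 0 y - Y 1 y * X 0 y).
have D1 : D x = -1 by rewrite /D X0 X1 X2 X3 Y0 Y1 Y2 Y3; ring.
have hN := is_deriveM (br 3%:R 0) (br 1 2%:R).
have hD := is_deriveM (br 3%:R 2%:R) (br 1 0).
have hDV := @is_deriveV _ _ D x v _ _ hD.
have D0 : D x != 0 by rewrite D1 oppr_eq0 oner_eq0.
apply: is_derive_eq (is_deriveM hN (hDV D0)) _.
rewrite -[(_ * _) x]/(_ x * _ x) D1 X0 X1 X2 X3 Y0 Y1 Y2 Y3 /GRing.scale /=.
rewrite sqrrN expr1n invr1 invrN1.
ring.
Qed.
End CrossRatio.

Section KnOpen.
Local Open Scope classical_set_scope.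
Local Open Scope ring_scope.

Lemma near_neq0 (K : numFieldType) (V : normedModType K) (f : V -> K) (x : V) :
  differentiable f x -> f x != 0 -> \near x, f x != 0.
Proof.
move=> /differentiable_continuous fc fx0.
apply: (fc [set y | y != 0]); exists `|f x|; first by rewrite /= normr_gt0.
move=> y; rewrite /= => yltfx.
by apply/eqP => y0; move: yltfx; rewrite y0 subr0 ltxx.
Qed.

Lemma avoiding_near (K : numFieldType) d (lam : 'rV[K]_d) (c : K) :
  (forall i, lam 0 i != c) ->
  nbhs lam [set mu : 'rV[K]_d | forall i, mu 0 i != c].
Proof.
move=> lam_c.
apply: (@filter_forall _ _ (fun j => [set mu : 'rV[K]_d | mu 0 j != c]) (nbhs lam)) => j.
have dcj : differentiable (fun mu : 'rV[K]_d => mu 0 j - c) lam.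
  apply: differentiableB; [exact: differentiable_coord | exact: differentiable_cst].
have := near_neq0 dcj; rewrite subr_eq0 => /(_ (lam_c j)).
by apply: filterS => mu; rewrite subr_eq0.
Qed.

Lemma distinct_near (K : numFieldType) d (lam : 'rV[K]_d) :
  (forall i j, i != j -> lam 0 i != lam 0 j) ->
  nbhs lam [set mu : 'rV[K]_d | forall i j, i != j -> mu 0 i != mu 0 j].
Proof.
move=> lam_neq.
have : nbhs lam [set mu : 'rV[K]_d | forall ij : 'I_d * 'I_d,
    ij.1 != ij.2 -> mu 0 ij.1 != mu 0 ij.2].
  apply: (@filter_forall _ _ (fun ij : 'I_d * 'I_d => [set mu : 'rV[K]_d |
    ij.1 != ij.2 -> mu 0 ij.1 != mu 0 ij.2]) (nbhs lam)) => -[i j] /=.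
  have [->|ij] := eqVneq i j; first by apply: filterE => mu /=; rewrite eqxx.
  have dij : differentiable (fun mu : 'rV[K]_d => mu 0 i - mu 0 j) lam.
    by apply: differentiableB; exact: differentiable_coord.
  have := near_neq0 dij; rewrite subr_eq0 => /(_ (lam_neq _ _ ij)).
  by apply: filterS => mu /=; rewrite subr_eq0 => + _.
by apply: filterS => mu muP i j; exact: (muP (i, j)).
Qed.

Lemma Kn_near (R : realType) d (lam : 'rV[(R[i] : numFieldType)]_d) :
  Kn lam -> nbhs lam (@Kn R d).
Proof.
move=> [lam01 lam_neq].
have n0 := avoiding_near (fun i => (lam01 i).1).
have n1 := avoiding_near (fun i => (lam01 i).2).
have nn := distinct_near lam_neq.
by move: n0 n1 nn; apply: filterS3 => mu mu0 mu1 mu_neq; split.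
Qed.

End KnOpen.

(** * The Jacobian of g_sigma at a fixed configuration *)

Section Jacobian.
Local Open Scope classical_set_scope.
Local Open Scope ring_scope.
Local Open Scope complex_scope.
Context {R : realType} {d : nat}.
Local Notation C := R[i].
Local Notation K := (R[i] : numFieldType).
Local Notation V := 'rV[K]_d.
Implicit Types (lam mu v : V) (s : {perm 'I_(3 + d)}).

(** A tangent vector of the configuration space moves the marked points other
    than 0, 1 and infinity. *)
Definition point_displacement v (i : 'I_(3 + d)) : K :=
  if fintype.split i is inr j then v 0 j else 0.

Lemma point_displacement_lshift v k : point_displacement v (lshift d k) = 0.
Proof. by rewrite /point_displacement -[lshift d k]/(unsplit (inl k)) unsplitK. Qed.

Lemma point_displacement_rshift v j : point_displacement v (rshift 3 j) = v 0 j.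
Proof. by rewrite /point_displacement -[rshift 3 j]/(unsplit (inr j)) unsplitK. Qed.

Lemma is_derive_hcoord lam v i :
  is_derive lam v (fun mu => (hcoord (zpt mu i)).1 : K) (point_displacement v i) /\
  is_derive lam v (fun mu => (hcoord (zpt mu i)).2 : K) 0.
Proof.
rewrite -(splitK i); case: (fintype.split i) => j /=.
  rewrite point_displacement_lshift; under eq_fun do rewrite zpt_lshift.
  under [X in _ /\ is_derive _ _ X _]eq_fun do rewrite zpt_lshift.
  by split; exact: is_derive_cst.
rewrite point_displacement_rshift; under eq_fun do rewrite zpt_rshift.
under [X in _ /\ is_derive _ _ X _]eq_fun do rewrite zpt_rshift.
split; last exact: is_derive_cst.
have dj := @differentiable_coord K 1 d lam 0 j.
split; first exact: diff_derivable.
rewrite deriveE //=.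
have @cj : {linear V -> K}.
  by exists (fun N : V => N 0 j); do 2![eexists]; do ?[constructor];
     rewrite ?mxE// => ? *; rewrite ?mxE//; move=> ?; rewrite !mxE.
by rewrite (_ : (fun N : V => N 0 j) = cj) // diff_lin //; exact: coord_continuous.
Qed.

Lemma differentiable_hcoord lam i :
  differentiable (fun mu => (hcoord (zpt mu i)).1 : K) lam /\
  differentiable (fun mu => (hcoord (zpt mu i)).2 : K) lam.
Proof.
rewrite -(splitK i); case: (fintype.split i) => j /=.
  under eq_fun do rewrite zpt_lshift.
  under [X in _ /\ differentiable X _]eq_fun do rewrite zpt_lshift.
  by split; exact: differentiable_cst.
under eq_fun do rewrite zpt_rshift.
under [X in _ /\ differentiable X _]eq_fun do rewrite zpt_rshift.
split; [exact: differentiable_coord | exact: differentiable_cst].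
Qed.

Lemma cross_ratioE (p q0 q1 q2 : C * C) :
  cross_ratio p q0 q1 q2 =
  odflt 0 (of_hcoord (bracket p q0 * bracket q1 q2, bracket p q2 * bracket q1 q0)).
Proof.
rewrite /cross_ratio /of_hcoord /bracket /=; case: eqP => [->|//].
by rewrite invr0 mulr0.
Qed.

Lemma g_cross_ratio lam s j : Kn lam ->
  let P i := hcoord (zpt lam ((s^-1)%g i)) in
  g_ s lam 0 j = cross_ratio (P (rshift 3 j)) (P (lshift d 0)) (P (lshift d 1)) (P (lshift d 2%:R)).
Proof.
move=> lamK P; rewrite /g_ mem_set // mxE.
have [lf fz] := normalizing_lft_perm lamK (s^-1)%g.
by rewrite (f_uniq lamK lf fz) normalizing_lftE cross_ratioE.
Qed.

Lemma cross_ratio_mat_act (a b c e : C) (k : 'I_4 -> C) (p : 'I_4 -> C * C) :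
  a * e - b * c != 0 -> (forall i, k i != 0) ->
  let q i := scale_pt (k i) (mat_act a b c e (p i)) in
  cross_ratio (q 3%:R) (q 0) (q 1) (q 2%:R) = cross_ratio (p 3%:R) (p 0) (p 1) (p 2%:R).
Proof.
move=> det0 k0 q.
have br i j : (q i).1 * (q j).2 - (q i).2 * (q j).1 =
    (k i * k j * (a * e - b * c)) * ((p i).1 * (p j).2 - (p i).2 * (p j).1).
  by rewrite /q /=; ring.
rewrite /cross_ratio !br; set D := a * e - b * c.
have X0 : k 0 * k 1 * k 2%:R * k 3%:R * D ^+ 2 != 0 by rewrite !mulf_neq0 ?expf_neq0.
rewrite -[RHS]mul1r -(divff X0) mulf_div; congr (_ / _); ring.
Qed.

Section AtFixedPoint.
Context {lam : V} (lamK : Kn lam) {s : {perm 'I_(3 + d)}} {a b c e : C}.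
Local Notation det := (a * e - b * c).
Context (det0 : det != 0).
Context (kappa : 'I_(3 + d) -> C) (kappa0 : forall i, kappa i != 0).
Context (act_kappa : forall i, mat_act a b c e (hcoord (zpt lam ((s^-1)%g i))) =
  scale_pt (kappa i) (hcoord (zpt lam i))).

(** The derivative at the marked point of index [s^-1 i] of the transformation,
    which carries it to the marked point of index [i]. *)
Definition multiplier i : C := det / kappa i ^+ 2.

(* Transported by the transformation fixed at lam and rescaled, the relabelled
   points pass through the original configuration at mu = lam, so that
   the derivative of the cross ratio is needed only at the points 0, 1 and
   infinity. *)
Let Q i mu := scale_pt (kappa i)^-1 (mat_act a b c e (hcoord (zpt mu ((s^-1)%g i)))).

Let Q_lam i : Q i lam = hcoord (zpt lam i).
Proof.
rewrite /Q act_kappa /scale_pt /= !mulrA !mulVf // !mul1r.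
by case: (hcoord _).
Qed.

(* Indices 0, 1, 2 are the reference points, and 3 is the j-th free point. *)
Let idx (j : 'I_d) (i : 'I_4) : 'I_(3 + d) :=
  if unlift ord_max i is Some k then lshift d k else rshift 3 j.

Let idxE j : [/\ idx j 0 = lshift d 0, idx j 1 = lshift d 1, idx j 2%:R = lshift d 2%:R
  & idx j 3%:R = rshift 3 j].
Proof.
split; rewrite /idx.
- by case: unliftP => // k /(congr1 val) /=; rewrite /bump leqNgt ltn_ord add0n => k0;
    congr lshift; apply: val_inj.
- by case: unliftP => // k /(congr1 val) /=; rewrite /bump leqNgt ltn_ord add0n => k0;
    congr lshift; apply: val_inj.
- by case: unliftP => // k /(congr1 val) /=; rewrite /bump leqNgt ltn_ord add0n => k0;
    congr lshift; apply: val_inj.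
- by case: unliftP => // k /(congr1 val) /=; rewrite /bump leqNgt ltn_ord add0n => k0;
    have := ltn_ord k; rewrite -k0.
Qed.

Let F j mu : K := cross_ratio (Q (idx j 3%:R) mu) (Q (idx j 0) mu) (Q (idx j 1) mu)
  (Q (idx j 2%:R) mu).

Let g_F : nbhs lam [set mu : V | forall j, F j mu = g_ s mu 0 j].
Proof.
apply: filterS (Kn_near lamK) => mu muK j.
rewrite g_cross_ratio // /F /Q.
rewrite (@cross_ratio_mat_act a b c e (fun i => (kappa (idx j i))^-1)
  (fun i => hcoord (zpt mu ((s^-1)%g (idx j i))))) //; last first.
  by move=> i; rewrite invr_eq0.
by have [-> -> -> ->] := idxE j.
Qed.

Let is_derive_Q v i :
  is_derive lam v (fun mu => (Q i mu).1 : K)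
    ((kappa i)^-1 * (a * point_displacement v ((s^-1)%g i))) /\
  is_derive lam v (fun mu => (Q i mu).2 : K)
    ((kappa i)^-1 * (c * point_displacement v ((s^-1)%g i))).
Proof.
have [d1 d2] := is_derive_hcoord lam v ((s^-1)%g i).
split.
- apply: is_derive_eq (is_deriveZ (kappa i)^-1 (is_deriveD (is_deriveZ a d1) (is_deriveZ b d2))) _.
  by rewrite /GRing.scale /= mulr0 addr0.
- apply: is_derive_eq (is_deriveZ (kappa i)^-1 (is_deriveD (is_deriveZ c d1) (is_deriveZ e d2))) _.
  by rewrite /GRing.scale /= mulr0 addr0.
Qed.

Let differentiable_Q i :
  differentiable (fun mu => (Q i mu).1 : K) lam /\
  differentiable (fun mu => (Q i mu).2 : K) lam.
Proof.
have [d1 d2] := differentiable_hcoord lam ((s^-1)%g i).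
split.
- have dQ := differentiableD (differentiableZ a d1) (differentiableZ b d2).
  have {}dQ := differentiableZ (kappa i)^-1 dQ; exact: dQ.
- have dQ := differentiableD (differentiableZ c d1) (differentiableZ e d2).
  have {}dQ := differentiableZ (kappa i)^-1 dQ; exact: dQ.
Qed.

Let differentiable_F j : differentiable (F j) lam.
Proof.
have br i k : differentiable (fun mu => (Q i mu).1 * (Q k mu).2 - (Q i mu).2 * (Q k mu).1 : K) lam.
  have [i1 i2] := differentiable_Q i; have [k1 k2] := differentiable_Q k.
  exact: differentiableB (differentiableM i1 k2) (differentiableM i2 k1).
apply: differentiableM; first exact: differentiableM (br _ _) (br _ _).
apply: differentiableV; first exact: differentiableM (br _ _) (br _ _).
have [-> -> -> ->] := idxE j.
rewrite /GRing.mul_fun !Q_lam !zpt_lshift zpt_rshift /=.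
by rewrite !mulr0 !mulr1 sub0r !mulN1r !subr0 oppr_eq0 oner_eq0.
Qed.

Lemma g_differentiable : differentiable (g_ s : V -> V) lam.
Proof.
apply: near_eq_differentiable (differentiable_row differentiable_F).
apply: filterS g_F => mu muF; apply/rowP => j; rewrite mxE; exact: muF.
Qed.

(* The bracket of the displacement of Q i with Q i itself is the displacement
   in an affine coordinate. *)
Let displacement_multiplier v i :
  (kappa i)^-1 * (a * point_displacement v ((s^-1)%g i)) * (hcoord (zpt lam i)).2 -
  (kappa i)^-1 * (c * point_displacement v ((s^-1)%g i)) * (hcoord (zpt lam i)).1 =
  multiplier i * point_displacement v ((s^-1)%g i).
Proof.
have yv : (hcoord (zpt lam ((s^-1)%g i))).2 * point_displacement v ((s^-1)%g i)
    = point_displacement v ((s^-1)%g i).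
  rewrite -(splitK ((s^-1)%g i)); case: (fintype.split _) => j /=.
    by rewrite point_displacement_lshift mulr0.
  by rewrite zpt_rshift mul1r.
have := act_kappa i; rewrite /mat_act /scale_pt => -[E1 E2].
rewrite /multiplier -{3}yv; move: (point_displacement v _) => t.
move: E1 E2; move: (hcoord _) (hcoord _) => [x y] [x' y'] /= E1 E2.
have -> : x = (kappa i)^-1 * (a * x' + b * y') by rewrite E1 mulKf.
have -> : y = (kappa i)^-1 * (c * x' + e * y') by rewrite E2 mulKf.
by field.
Qed.

Lemma is_derive_g v j : let z := lam 0 j in
  let tau i := multiplier i * point_displacement v ((s^-1)%g i) in
  is_derive lam v (fun mu => g_ s mu 0 j : K)
    (tau (rshift 3 j) - (1 - z) * tau (lshift d 0) - z * tau (lshift d 1) -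
     z * (z - 1) * tau (lshift d 2%:R)).
Proof.
move=> z tau.
have Fg : nbhs lam [set mu : V | F j mu = (g_ s mu 0 j : K)] by apply: filterS g_F => mu; exact.
apply: (near_eq_is_derive Fg).
have [i0 i1 i2 i3] := idxE j.
have dX i := (is_derive_Q v (idx j i)).1; have dY i := (is_derive_Q v (idx j i)).2.
apply: is_derive_eq (is_derive_cross_ratio dX dY _ _) _.
- by split; rewrite ?i0 ?i1 ?i2 ?i3 Q_lam ?zpt_lshift ?zpt_rshift.
- by split; rewrite ?i0 ?i1 ?i2 ?i3 Q_lam ?zpt_lshift ?zpt_rshift.
rewrite i0 i1 i2 i3 /tau -!displacement_multiplier !zpt_lshift zpt_rshift /=.
rewrite -/z; ring.
Qed.

Lemma X_g_entry i j : let z := lam 0 i in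
  let tau k := multiplier k * ((s^-1)%g k == rshift 3 j)%:R in
  X_ lam (g_ s) i j =
  tau (rshift 3 i) - (1 - z) * tau (lshift d 0) - z * tau (lshift d 1) -
     z * (z - 1) * tau (lshift d 2%:R).
Proof.
move=> z tau; rewrite /X_ mxE jacobian_entry; last exact: g_differentiable.
have [_ ->] := is_derive_g (delta_mx 0 j) i; rewrite -/z.
have deltaE k : point_displacement (delta_mx 0 j) k = (k == rshift 3 j)%:R.
  rewrite -(splitK k); case: (fintype.split k) => l /=.
    by rewrite point_displacement_lshift eq_lrshift.
  by rewrite point_displacement_rshift mxE eqxx (inj_eq (@rshift_inj _ _)).
by rewrite /tau !deltaE.
Qed.

(* The quadratic forms dual to the points 0, 1 and infinity, that is, the
   quadratic vector fields which vanish at two of these points. *)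
Let phi (k : nat) (p : C * C) : C :=
  match k with
  | 0 => p.2 ^+ 2 - p.1 * p.2
  | 1 => p.1 * p.2
  | _ => p.1 ^+ 2 - p.1 * p.2
  end.

Let sum_points (k : 'I_3) :
  \sum_j phi k (hcoord (zpt lam (rshift 3 j))) * ((s^-1)%g (lshift d k) == rshift 3 j)%:R =
  phi k (hcoord (zpt lam ((s^-1)%g (lshift d k)))) - (s (lshift d k) == lshift d k)%:R.
Proof.
have -> : (s (lshift d k) == lshift d k) = ((s^-1)%g (lshift d k) == lshift d k).
  by rewrite -(inj_eq (@perm_inj _ (s^-1)%g)) permK eq_sym.
move: ((s^-1)%g _) => i; rewrite -(splitK i); case: (fintype.split i) => l /=.
  rewrite big1 => [|j _]; last by rewrite eq_lrshift mulr0.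
  rewrite (inj_eq (@lshift_inj _ _)) zpt_lshift.
  case: k l => [[|[|[|k]]] lt_k] [[|[|[|l]]] lt_l] //=;
    rewrite /phi /=; ring.
rewrite (bigD1 l) //= eqxx mulr1 big1 ?addr0 => [|j jl]; last first.
  by rewrite (inj_eq (@rshift_inj _ _)) eq_sym (negPf jl) mulr0.
by rewrite eq_rlshift subr0.
Qed.

(** The tangent space of the configuration space is the space of displacements
    of all marked points modulo the quadratic vector fields (the Lie algebra of
    the group of linear fractional transformations).  On displacements the
    differential is a monomial map, whose trace is the sum of the multipliers at
    the fixed marked points; on the vector fields it is the adjoint action, whose
    trace is [(a + e) ^+ 2 / det - 1]. *)
Theorem mxtrace_X_g :
  \tr (X_ lam (g_ s)) =
  \sum_(i | s i == i) multiplier i - ((a + e) ^+ 2 / det - 1).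
Proof.
have sV i : ((s^-1)%g i == i) = (s i == i).
  by rewrite -(inj_eq (@perm_inj _ s)) permKV eq_sym.
have l1 : lift ord0 ord0 = 1 :> 'I_3 by apply: val_inj.
have l2 : lift ord0 (lift ord0 ord0) = 2%:R :> 'I_3 by apply: val_inj.
rewrite /mxtrace.
have -> : \sum_i X_ lam (g_ s) i i =
    \sum_(i < d) multiplier (rshift 3 i) * (s (rshift 3 i) == rshift 3 i)%:R -
    \sum_(k < 3) multiplier (lshift d k) *
      (phi k (hcoord (zpt lam ((s^-1)%g (lshift d k)))) - (s (lshift d k) == lshift d k)%:R).
  under [X in _ - X]eq_bigr => k _ do rewrite -sum_points mulr_sumr.
  rewrite [X in _ - X]exchange_big -sumrB; apply: eq_bigr => i _.
  rewrite X_g_entry !big_ord_recl big_ord0 sV zpt_rshift /phi /= l1 l2.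
  ring.
rewrite [X in _ = X - _]big_mkcond big_split_ord /=.
have phi_sum : \sum_(k < 3) multiplier (lshift d k) *
    phi k (hcoord (zpt lam ((s^-1)%g (lshift d k)))) = (a + e) ^+ 2 / det - 1.
  have inv_act k : hcoord (zpt lam ((s^-1)%g (lshift d k))) =
      scale_pt (kappa (lshift d k) / det)
        (mat_act e (- b) (- c) a (hcoord (zero_one_infty k))).
    rewrite -(zpt_lshift lam k).
    have := act_kappa (lshift d k); rewrite /mat_act /scale_pt => -[E1 E2].
    move: E1 E2; move: (hcoord _) (hcoord _) => [x y] [x' y'] /= E1 E2.
    congr (_, _).
    - transitivity ((e * (kappa (lshift d k) * x) - b * (kappa (lshift d k) * y)) / det).
        by rewrite -E1 -E2; field.
      by field.
    - transitivity ((- c * (kappa (lshift d k) * x) + a * (kappa (lshift d k) * y)) / det).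
        by rewrite -E1 -E2; field.
      by field.
  under eq_bigr do rewrite inv_act.
  rewrite !big_ord_recl big_ord0 /multiplier /phi /=.
  by field; rewrite det0 !kappa0.
under [X in _ - X = _]eq_bigr do rewrite mulrBr.
rewrite sumrB phi_sum; move: (_ / det - 1) => T.
rewrite opprB addrA; congr (_ - _).
rewrite addrC; congr (_ + _).
- apply: eq_bigr => k _; case: eqP => _; by rewrite ?mulr1 ?mulr0.
- apply: eq_bigr => k _; case: eqP => _; by rewrite ?mulr1 ?mulr0.
Qed.

End AtFixedPoint.

End Jacobian.

(** * The Jacobian representation of a stabilizer *)

Section JacobianComp.
Local Open Scope ring_scope.

Lemma jacobian_comp (K : numFieldType) m n q (f : 'rV[K]_n -> 'rV[K]_q)
    (g : 'rV[K]_m -> 'rV[K]_n) p :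
  differentiable g p -> differentiable f (g p) ->
  jacobian (f \o g) p = jacobian g p *m jacobian f (g p).
Proof.
move=> dg df; apply/row_matrixP => i.
by rewrite row_mul !rowE /jacobian !mul_rV_lin1 (diff_comp dg df).
Qed.

Lemma jacobian_id (K : numFieldType) m (p : 'rV[K]_m) : jacobian id p = 1%:M.
Proof.
by apply/row_matrixP => i; rewrite rowE /jacobian mul_rV_lin1 diff_val row1.
Qed.

End JacobianComp.

Section StabilizerRep.
Local Open Scope classical_set_scope.
Local Open Scope ring_scope.
Local Open Scope complex_scope.
Context {R : realType} {d : nat}.
Local Notation C := R[i].
Local Notation K := (R[i] : numFieldType).
Local Notation V := 'rV[K]_d.
Implicit Types (lam mu v : V) (s : {perm 'I_(3 + d)}).

(** A fixed point of [g_ s] is a configuration which the transformation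
    [f_ s lam] permutes. *)
Lemma fixed_config_factors lam s a b c e : Kn lam -> g_ s lam = lam ->
  a * e - b * c != 0 -> f_ s lam = lft a b c e ->
  exists2 kappa : 'I_(3 + d) -> C, forall i, kappa i != 0 &
    forall i, mat_act a b c e (hcoord (zpt lam ((s^-1)%g i))) =
      scale_pt (kappa i) (hcoord (zpt lam i)).
Proof.
move=> lamK gs det0 fE.
have /choice[kappa kappaP] : forall i, exists k, k != 0 /\
    mat_act a b c e (hcoord (zpt lam ((s^-1)%g i))) = scale_pt k (hcoord (zpt lam i)).
  move=> i; have [k k0 E] := mat_act_hcoord (zpt lam ((s^-1)%g i)) det0.
  by exists k; split=> //; rewrite E -fE -g_zpt // gs.
by exists kappa => i; case: (kappaP i).
Qed.

Lemma stabilizer_differentiable lam s : Kn lam -> g_ s lam = lam ->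
  differentiable (g_ s : V -> V) lam.
Proof.
move=> lamK gs; have [[a [b [c [e [det0 fE]]]]] _] := f_P lamK s.
have [kappa kappa0 kappaE] := fixed_config_factors lamK gs det0 fE.
exact: g_differentiable kappaE.
Qed.

(** This is the chain rule at a common fixed point. *)
Lemma stabilizer_rep lam : Kn lam -> is_rep (stabilizer lam) (X_ lam).
Proof.
move=> lamK; split.
  by rewrite /X_ jacobian_id trmx1.
move=> f g [[s _ <-] fs] [[p _ <-] gp].
rewrite /X_ -trmx_mul; congr (_ ^T).
have ds := stabilizer_differentiable lamK fs; have dp := stabilizer_differentiable lamK gp.
have ds' : differentiable (g_ s : V -> V) (g_ p lam : V) by rewrite gp.
have -> := jacobian_comp dp ds'.
move: gp => /= gp.
rewrite gp.
by [].
Qed.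

End StabilizerRep.

(** * The tetrahedral group *)

Section Tetrahedral.
Local Open Scope classical_set_scope.
Local Open Scope ring_scope.
Local Open Scope complex_scope.
Context {R : realType}.
Local Notation C := R[i].
Local Notation sphere := (@sphere R).
Local Notation w := (@w R).
Local Notation sqrt2 := (@sqrt2 R).
Local Notation sqrt3 := (@sqrt3 R).

(** The half turns about two of the axes through midpoints of opposite edges,
    the second being the conjugate of the first by [rot_w]. *)
Definition edge_turn : sphere -> sphere := lft (- 1) sqrt2 sqrt2 1.
Definition edge_turn' : sphere -> sphere := rot_w \o edge_turn \o (rot_w \o rot_w).

Lemma sqrt2_sqr : sqrt2 ^+ 2 = 2%:R.
Proof. by rewrite /sqrt2 -rmorphXn /= sqr_sqrtr ?ler0n // rmorph_nat. Qed.

Lemma sqrt3_sqr : sqrt3 ^+ 2 = 3%:R.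
Proof. by rewrite /sqrt3 -rmorphXn /= sqr_sqrtr ?ler0n // rmorph_nat. Qed.

Lemma w_sqr : w ^+ 2 = - w - 1.
Proof. by apply/eqP; rewrite -subr_eq0 -(@w_root R); apply/eqP; ring. Qed.

Lemma w_neq0 : w != 0.
Proof.
by apply/eqP => w0; have := @w_cube R; rewrite w0 expr0n => /eqP; rewrite eq_sym oner_eq0.
Qed.

Lemma w_im : complex.Im w != 0.
Proof.
rewrite /w /=; apply: lt0r_neq0; have pi0 := @pi_gt0 R.
by apply: sin_gt0_pi; rewrite divr_gt0 ?mulr_gt0 //= ltr_pdivrMr // mulrC ltr_pM2l // ltr_nat.
Qed.

Lemma sqrt2_neq0 : sqrt2 != 0.
Proof.
by apply/eqP => s0; have := sqrt2_sqr; rewrite s0 expr0n => /eqP; rewrite eq_sym pnatr_eq0.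
Qed.

Lemma lft_prop k (a b c d a' b' c' d' : C) : k != 0 ->
  [/\ a = k * a', b = k * b', c = k * c' & d = k * d'] ->
  lft a b c d = lft a' b' c' d'.
Proof. by move=> k0 [-> -> -> ->]; exact: lft_scale. Qed.

Lemma three_neq0 : (3%:R : C) != 0.
Proof. by rewrite pnatr_eq0. Qed.

Lemma rot_w_det : w * 1 - 0 * 0 != 0.
Proof. by rewrite mulr1 mulr0 subr0 w_neq0. Qed.

Lemma edge_turn_det : -1 * 1 - sqrt2 * sqrt2 = - 3%:R :> C.
Proof. by rewrite -expr2 sqrt2_sqr; ring. Qed.

Lemma edge_turn_det0 : -1 * 1 - sqrt2 * sqrt2 != 0 :> C.
Proof. by rewrite edge_turn_det oppr_eq0 three_neq0. Qed.

Lemma rot_w2E : rot_w \o rot_w = lft (w ^+ 2) 0 0 1.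
Proof.
by rewrite /rot_w lft_comp ?rot_w_det //; congr lft; rewrite ?expr2; ring.
Qed.

Lemma rot_w3 : rot_w \o (rot_w \o rot_w) = id :> (sphere -> sphere).
Proof.
rewrite rot_w2E /rot_w lft_comp ?mulr1 ?mulr0 ?subr0 ?expf_neq0 ?w_neq0 //.
rewrite -(lft_scalar (oner_neq0 _)); congr lft; rewrite -?exprS ?(@w_cube R); ring.
Qed.

Lemma edge_turn'E : edge_turn' = lft (- 1) (sqrt2 * w) (sqrt2 * w ^+ 2) 1.
Proof.
rewrite /edge_turn' rot_w2E /edge_turn /rot_w lft_comp ?edge_turn_det0 //.
rewrite lft_comp ?mulr1 ?mulr0 ?subr0 ?expf_neq0 ?w_neq0 //.
have w3 := @w_cube R.
by congr lft; rewrite ?mulr0 ?mul0r ?addr0 ?add0r ?mulr1 ?mul1r // ?mulrN1 ?mulNr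
  -?exprS ?w3 // mulrC.
Qed.

Lemma edge_turn'_det0 : -1 * 1 - sqrt2 * w * (sqrt2 * w ^+ 2) != 0 :> C.
Proof.
have -> : sqrt2 * w * (sqrt2 * w ^+ 2) = sqrt2 ^+ 2 * w ^+ 3 by ring.
by rewrite (@w_cube R) mulr1 sqrt2_sqr [X in X != 0](_ : _ = - 3%:R) ?oppr_eq0 ?three_neq0 //; ring.
Qed.

Lemma tetrahedral_relations :
  a4_relations (@comp sphere sphere sphere) id edge_turn edge_turn' rot_w.
Proof.
have w3 := @w_cube R; have w2 := w_sqr; have s2 := sqrt2_sqr.
have aa : edge_turn \o edge_turn = id :> (sphere -> sphere).
  rewrite /edge_turn lft_comp ?edge_turn_det0 // -(lft_scalar three_neq0); congr lft; ring: s2.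
split=> //.
- rewrite /edge_turn'.
  have -> : rot_w \o edge_turn \o (rot_w \o rot_w) \o (rot_w \o edge_turn \o (rot_w \o rot_w))
     = rot_w \o edge_turn \o (rot_w \o (rot_w \o rot_w)) \o edge_turn \o (rot_w \o rot_w)
     :> (sphere -> sphere).
    by [].
  rewrite rot_w3; have -> : rot_w \o edge_turn \o id \o edge_turn \o (rot_w \o rot_w) =
    rot_w \o (edge_turn \o edge_turn) \o (rot_w \o rot_w) :> (sphere -> sphere) by [].
  by rewrite aa; exact: rot_w3.
- rewrite edge_turn'E /edge_turn !lft_comp ?edge_turn_det0 ?edge_turn'_det0 //.
  apply: (@lft_prop (- 1)); first by rewrite oppr_eq0 oner_eq0.
  by split; ring: w2 s2.
- exact: rot_w3.
- rewrite /edge_turn'.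
  by rewrite -[RHS]/(rot_w \o edge_turn \o (rot_w \o (rot_w \o rot_w))) rot_w3.
- rewrite edge_turn'E /edge_turn /rot_w !lft_comp ?rot_w_det ?edge_turn'_det0 //.
  apply: esym; apply: (@lft_prop (2%:R * w + 1)).
    apply/eqP => k0; have : (2%:R * w + 1) ^+ 2 = - 3%:R by ring: w2.
    by rewrite k0 expr0n => /eqP; rewrite eq_sym oppr_eq0 (negPf three_neq0).
  by split; ring: w2 s2.
Qed.

Lemma edge_turn_neq : edge_turn <> id.
Proof.
move=> /(congr1 (fun f => f (Some 0))); rewrite /edge_turn /= mulr0 !add0r oner_eq0.
by rewrite mulr0 add0r divr1 => /Some_inj/eqP; rewrite (negPf sqrt2_neq0).
Qed.

(** The rotations of the tetrahedron, indexed by the model of A4. *)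
Definition trot : a4 -> sphere -> sphere :=
  a4_word (@comp sphere sphere sphere) id edge_turn edge_turn' rot_w.

Lemma trotM x y : trot x \o trot y = trot (a4_mul x y).
Proof. exact: a4_wordM tetrahedral_relations x y. Qed.

Lemma trot1 : trot a4_one = id.
Proof. exact: a4_word1 tetrahedral_relations. Qed.

Lemma trot_inj : injective trot.
Proof. exact: a4_word_inj tetrahedral_relations edge_turn_neq. Qed.

Lemma trot_inv x : trot x \o trot (a4_inv x) = id /\ trot (a4_inv x) \o trot x = id.
Proof.
by rewrite !trotM a4_mulV a4_mulVl trot1. Qed.

Lemma trotK x y : trot (a4_inv x) (trot x y) = y.
Proof. by rewrite -[LHS]/((trot (a4_inv x) \o trot x) y) trotM a4_mulVl trot1. Qed.

Lemma T_range : @T R = range trot.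
Proof.
apply/seteqP; split.
  rewrite /T /generated_group; apply: smallest_sub.
    split; first by exists a4_one => //; exact: trot1.
      by move=> f g [x _ <-] [y _ <-]; exists (a4_mul x y) => //; rewrite trotM.
    move=> f [x _ <-]; exists (trot (a4_inv x)); have [E1 E2] := trot_inv x.
    by split=> //; exists (a4_inv x).
  move=> f [->|->]; last by exists ((true, false), 0).
  by exists ((false, false), 1).
move=> f [x _ <-] A [[A1 AM AV] Agen].
have Ar : A rot_w by apply: Agen; left.
have Aa : A edge_turn by apply: Agen; right.
have Ab : A edge_turn' by exact: (AM _ _ (AM _ _ Ar Aa) (AM _ _ Ar Ar)).
case: x => [[u v] k]; rewrite /trot /a4_word /klein_word /=.
apply: (AM); first by apply: (AM); [case: u | case: v].
by elim: (k : nat) => [|j IH] //=; exact: AM.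
Qed.

Lemma T_orbitE y : T_orbit y = range (fun x => trot x y).
Proof.
rewrite /T_orbit T_range; apply/seteqP; split=> [z [_ [x _ <-] <-]|z [x _ <-]].
  by exists x.
by exists (trot x) => //; exists x.
Qed.

(** The orbit is the image of the twelve elements of A4, and has twelve
    elements. *)
Lemma T_orbit_free y : is_B_T (T_orbit y) -> injective (fun x => trot x y).
Proof.
move=> [_]; rewrite T_orbitE => /pcard_eqP[h].
have hI x : (h (trot x y) < 12)%N by apply: (@funS _ _ _ _ h); exists x.
pose g x := Ordinal (hI x).
have g_onto : g @: [set: a4]%SET = [set: 'I_12]%SET.
  apply/setP => i; rewrite inE; apply/imsetP.
  have [z [x _ <-] hz] : exists2 z, range (fun x => trot x y) z & h z = i.
    have := @surj _ _ _ _ h i (ltn_ord i). by [].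
  by exists x => //; apply: val_inj.
have /imset_injP ginj : #|g @: [set: a4]%SET| == #|[set: a4]%SET|.
  by rewrite g_onto !cardsT card_ord !card_prod !card_bool card_ord.
move=> x1 x2 E; apply: ginj; rewrite ?inE //; apply: val_inj.
by rewrite /= E.
Qed.

(** The points which belong to an orbit with fewer than twelve elements: those of
    the orbits F, V and E. *)
Definition has_rotation_axis (y : sphere) := exists2 x, x != a4_one & trot x y = y.

Lemma free_no_axis y z : injective (fun x => trot x y) -> T_orbit y z ->
  ~ has_rotation_axis z.
Proof.
rewrite T_orbitE => inj [x _ <-] [t /eqP t1 tx]; apply: t1.
have /inj tE : trot (a4_mul t x) y = trot x y by rewrite -trotM.
apply: trot_inj; rewrite trot1.
have [E _] := trot_inv x.
transitivity (trot (a4_mul t x) \o trot (a4_inv x)); last by rewrite tE.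
by rewrite -trotM -compA E.
Qed.

Lemma has_rotation_axis_trot x y : has_rotation_axis y -> has_rotation_axis (trot x y).
Proof.
move=> [t t1 ty]; exists (a4_mul (a4_mul x t) (a4_inv x)).
  apply: contra_neq t1 => E; have E' : trot x \o trot t = trot x.
    transitivity (trot (a4_mul (a4_mul x t) (a4_inv x)) \o trot x).
      by rewrite -!trotM -compA (trot_inv x).2.
    by rewrite E trot1.
  apply: trot_inj; rewrite trot1.
  transitivity (trot (a4_inv x) \o (trot x \o trot t)).
    by rewrite compA (trot_inv x).2.
  by rewrite E' (trot_inv x).2.
by rewrite -!trotM /= trotK ty.
Qed.

End Tetrahedral.

(** * Lifting rotations to a stabilizer *)

Section Transport.
Local Open Scope classical_set_scope.
Local Open Scope ring_scope.
Local Open Scope complex_scope.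
Context {R : realType} {d : nat} {lam : 'rV[R[i]]_d} (lamK : Kn lam).
Local Notation C := R[i].
Local Notation V := 'rV[C]_d.
Local Notation sphere := (@sphere R).
Context {psi : sphere -> sphere} (psi_lft : is_lft psi).
Local Notation y i := (psi (zpt lam i)).
Context (y_inv : forall x i, exists j, trot x (y i) = y j).

Let y_inj : injective (fun i => y i).
Proof. by move=> i j /(is_lft_inj psi_lft)/((KnP lam).1 lamK). Qed.

Let trot_perm_ex x : exists s : {perm 'I_(3 + d)}, forall i, trot x (y i) = y (s i).
Proof.
have /choice[s0 s0P] := y_inv x.
have s0_inj : injective s0.
  move=> i j sij; apply: y_inj; have := s0P j; rewrite -sij -s0P.
  by move=> /(congr1 (trot (a4_inv x))); rewrite !trotK.
by exists (perm s0_inj) => i; rewrite permE.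
Qed.

(** The permutation of the marked points induced by a rotation of the
    tetrahedron, which preserves the image of the configuration by [psi]. *)
Definition trot_perm x : {perm 'I_(3 + d)} := sval (cid (trot_perm_ex x)).

Lemma trot_permP x i : trot x (y i) = y (trot_perm x i).
Proof. by rewrite /trot_perm; case: (cid _). Qed.

(** The inverse of Phi, once [psi] is used to identify the rotations of the
    tetrahedron with symmetries of the configuration. *)
Definition lift_trot x : V -> V := g_ (trot_perm x).

Let is_lft_trot x : is_lft (@trot R x).
Proof.
have lr : is_lft (@rot_w R) by exists w, 0, 0, 1; split=> //; exact: rot_w_det.
have la : is_lft (@edge_turn R) by exists (-1), sqrt2, sqrt2, 1; split=> //; exact: edge_turn_det0.
have lb : is_lft (@edge_turn' R) by do !apply: is_lft_comp.
rewrite /trot /a4_word /klein_word; apply: is_lft_comp.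
  by apply: is_lft_comp; case: ifP => _ //; exact: is_lft_id.
by elim: (x.2 : nat) => [|k IH] /=; [exact: is_lft_id | exact: is_lft_comp].
Qed.

Lemma f_trot_perm x f : is_lft f -> psi \o f = trot x \o psi ->
  f_ (trot_perm x) lam = f.
Proof.
move=> lf fE; apply: f_uniq => // k; apply: (is_lft_inj psi_lft).
rewrite -[LHS]/((psi \o f) _) fE /= trot_permP permKV zpt_lshift //.
Qed.

Lemma lift_trot_fix x : lift_trot x lam = lam.
Proof.
have [psi' [lpsi' psi'K psiK]] := is_lft_inv psi_lft.
have fE := @f_trot_perm x (psi' \o trot x \o psi) _ _.
apply: zpt_eq => i; rewrite g_zpt // fE.
- rewrite /= trot_permP permKV -[psi' _]/((psi' \o psi) _) psi'K //.
- by apply: is_lft_comp => //; exact: is_lft_comp.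
- by rewrite -compA compA psiK.
Qed.

Lemma lift_trot_stabilizer x : stabilizer lam (lift_trot x).
Proof. by split; [exists (trot_perm x) | exact: lift_trot_fix]. Qed.

Lemma trot_permM x z : trot_perm (a4_mul x z) = (trot_perm z * trot_perm x)%g.
Proof.
apply/permP => i; apply: y_inj; rewrite permM -!trot_permP.
by rewrite -[RHS]/((trot x \o trot z) _) trotM.
Qed.

Lemma lift_trotM x z : lift_trot x \o lift_trot z = lift_trot (a4_mul x z).
Proof. by rewrite /lift_trot g_comp trot_permM. Qed.

Lemma lift_trot1 : lift_trot a4_one = id.
Proof.
rewrite /lift_trot -(@g_1 R d); congr (g_ _).
by apply/permP => i; apply: y_inj; rewrite -trot_permP trot1 perm1.
Qed.

Lemma trot_perm_uniq x s f : g_ s lam = lam -> f = f_ s lam -> psi \o f = trot x \o psi ->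
  s = trot_perm x.
Proof.
move=> gs fs fE; apply/permP => i; apply: y_inj.
rewrite -trot_permP -[RHS]/((trot x \o psi) _) -fE fs /=; congr psi.
by rewrite -[LHS](congr1 (fun mu => zpt mu (s i)) gs) g_zpt // permK.
Qed.

(** Multipliers at fixed points and the trace of the adjoint action are invariant
    under conjugation by [psi], so the trace can be computed on the model
    configuration, from a matrix of the rotation and its eigenvalues [eta] at
    the fixed points. *)
Lemma mxtrace_lift_trot x a b c e (eta : sphere -> C) :
  a * e - b * c != 0 -> trot x = lft a b c e ->
  (forall z, trot x z = z -> mat_act a b c e (hcoord z) = scale_pt (eta z) (hcoord z)) ->
  \tr (X_ lam (lift_trot x)) =
  \sum_(i | `[< trot x (y i) = y i >]) (a * e - b * c) / eta (y i) ^+ 2 -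
    ((a + e) ^+ 2 / (a * e - b * c) - 1).
Proof.
move=> det0 xE etaP.
have [p [q [r [t [psi0 psiE]]]]] := psi_lft.
have psi0' : t * p - - q * - r != 0 by rewrite mulrNN mulrC.
pose psi' := lft t (- q) (- r) p.
have psiK : psi \o psi' = id.
  rewrite psiE /psi' lft_comp // -(lft_scalar psi0); congr lft; ring.
have lpsi' : is_lft psi' by exists t, (- q), (- r), p.
have lf : is_lft (psi' \o trot x \o psi) by apply: is_lft_comp => //; exact: is_lft_comp.
have fE : f_ (trot_perm x) lam = psi' \o trot x \o psi.
  by apply: f_trot_perm => //; rewrite -compA compA psiK.
set D := p * t - q * r in psi0.
(* The entries of the product of the lifts of psi^-1, of the rotation and of
   psi, where psi^-1 is lifted by the adjugate of the lift of psi. *)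
pose a' := (t * a + - q * c) * p + (t * b + - q * e) * r.
pose b' := (t * a + - q * c) * q + (t * b + - q * e) * t.
pose c' := (- r * a + p * c) * p + (- r * b + p * e) * r.
pose e' := (- r * a + p * c) * q + (- r * b + p * e) * t.
have fE' : f_ (trot_perm x) lam = lft a' b' c' e'.
  by rewrite fE xE psiE /psi' lft_comp // lft_comp.
have det'E : a' * e' - b' * c' = D ^+ 2 * (a * e - b * c).
  by rewrite /a' /b' /c' /e' /D; ring.
have trE : a' + e' = D * (a + e) by rewrite /a' /e' /D; ring.
have det0' : a' * e' - b' * c' != 0 by rewrite det'E mulf_neq0 ?expf_neq0.
have [kappa kappa0 kappaE] := fixed_config_factors lamK (lift_trot_fix x) det0' fE'.
rewrite /lift_trot (mxtrace_X_g lamK det0' kappa0 kappaE) det'E trE.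
congr (_ - (_ - 1)); last first.
  by field; rewrite psi0 det0.
apply: eq_big => i.
  apply/eqP/asboolP; first by rewrite trot_permP => ->.
  by rewrite trot_permP => /y_inj.
move=> /eqP si; rewrite /multiplier det'E.
have [l l0 lE] := mat_act_hcoord (zpt lam i) psi0; rewrite -psiE in lE.
have etaE := etaP (y i) _; have {}etaE := etaE (etrans (trot_permP x i) (congr1 (fun j => y j) si)).
have kE : scale_pt (kappa i) (hcoord (zpt lam i)) = scale_pt (eta (y i) * D) (hcoord (zpt lam i)).
  rewrite -kappaE (_ : (trot_perm x)^-1%g i = i); last by rewrite -{1}si permK.
  transitivity (mat_act t (- q) (- r) p (mat_act a b c e (mat_act p q r t (hcoord (zpt lam i))))).
    by rewrite /mat_act /a' /b' /c' /e' /=; congr (_, _); ring.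
  rewrite lE.
  have -> : mat_act a b c e (scale_pt l (hcoord (y i))) =
      scale_pt l (scale_pt (eta (y i)) (hcoord (y i))).
    by rewrite -etaE /mat_act /scale_pt /=; congr (_, _); ring.
  transitivity (scale_pt (eta (y i)) (mat_act t (- q) (- r) p (scale_pt l (hcoord (y i))))).
    by rewrite /mat_act /scale_pt /=; congr (_, _); ring.
  rewrite -lE /mat_act /scale_pt /D /=; congr (_, _); ring.
have -> : kappa i = eta (y i) * D.
  move: kE; case: (zpt lam i) => [u|] [] /=; last by rewrite !mulr1.
  by move=> _; rewrite !mulr1.
have eta0 : eta (y i) != 0.
  apply/eqP => eta0; move: etaE; rewrite eta0 /scale_pt !mul0r => /(mat_act_eq0 det0).
  exact: hcoord_neq0.
by field; rewrite psi0 eta0.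
Qed.

End Transport.

(** * Vertices, face centers and edge midpoints *)

Section SpecialPoints.
Local Open Scope classical_set_scope.
Local Open Scope ring_scope.
Local Open Scope complex_scope.
Context {R : realType}.
Local Notation C := R[i].
Local Notation sphere := (@sphere R).
Local Notation w := (@w R).
Local Notation sqrt2 := (@sqrt2 R).
Local Notation sqrt3 := (@sqrt3 R).

(** Labels for the fourteen points of F, V and E: the face center 0, the vertex
    at infinity, and the points [c * w ^+ k] for four real numbers [c], which
    are the other face centers, the other vertices, and two families of edge
    midpoints. *)
Definition label : Type := (bool + 'I_4 * 'Z_3)%type.

(** The last two values are sqrt 2 / (1 - sqrt 3) and sqrt 2 / (1 + sqrt 3). *)
Definition spoint_radius (i : nat) : R :=
  match i with
  | 0 => Num.sqrt 2
  | 1 => - (Num.sqrt 2 / 2)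
  | 2 => - (Num.sqrt 2 * (1 + Num.sqrt 3) / 2)
  | _ => Num.sqrt 2 * (Num.sqrt 3 - 1) / 2
  end.

Definition spoint (u : label) : sphere :=
  match u with
  | inl b => if b then None else Some 0
  | inr (i, k) => Some ((spoint_radius i)%:C * w ^+ k)
  end.

(** How [rot_w] and [edge_turn] permute the labels. *)
Definition rot_label (u : label) : label :=
  if u is inr (i, k) then inr (i, k + 1) else u.

Definition turn_label (u : label) : label :=
  match u with
  | inl b => inr (if b then 1 else 0, 0)
  | inr (i, k) =>
    if (i < 2)%N then if k == 0 then inl (i == 1%N :> nat) else inr (i, - k)
    else if k == 0 then u else inr (if i == 2%N :> nat then 3%:R else 2%:R, k)
  end.

Definition kind_flag (kF kV kE : bool) (i : nat) : bool :=
  match i with 0 => kF | 1 => kV | _ => kE end.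

(** The booleans say whether face centers, vertices and edge midpoints are
    admitted, so that all types of configurations are treated at once. *)
Definition of_kind (kF kV kE : bool) (u : label) : bool :=
  match u with
  | inl b => if b then kV else kF
  | inr (i, _) => kind_flag kF kV kE i
  end.

Lemma of_kind_rot kF kV kE u : of_kind kF kV kE (rot_label u) = of_kind kF kV kE u.
Proof. by case: u => [b|[i k]]. Qed.

Lemma of_kind_turn kF kV kE u : of_kind kF kV kE (turn_label u) = of_kind kF kV kE u.
Proof.
case: u => [[]|[[[|[|[|[|i]]]] lt_i] k]] //=; by case: eqP.
Qed.

Lemma card_of_kind kF kV kE :
  #|[set u | of_kind kF kV kE u]%SET| = (4 * kF + 4 * kV + 6 * kE)%N.
Proof.
rewrite cardsE -sum1_card big_mkcond big_sumType /= big_bool !unfold_in /=.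
rewrite [X in (_ + X)%N](eq_bigr
  (fun p : 'I_4 * 'Z_3 => nat_of_bool (kind_flag kF kV kE p.1))); last first.
  by move=> [i k] _; rewrite unfold_in /=; case: kind_flag.
rewrite -(pair_bigA _ (fun (i : 'I_4) (k : 'Z_3) => nat_of_bool (kind_flag kF kV kE i))) /=.
rewrite !big_ord_recl !big_ord0 /=.
by case: kF kV kE => [] [] [].
Qed.

(** A nontrivial power of [w] is not real. *)
Lemma real_mul_w (x y : R) (k : 'Z_3) : k != 0 -> x%:C * w ^+ k = y%:C -> x = 0.
Proof.
have im (z : C) : x%:C * z = y%:C -> x * complex.Im z = 0.
  case: z => z1 z2 /(congr1 (@complex.Im R)) /=; rewrite mul0r addr0 //.
elim/Z3_ind: k => // _ E.
  have /eqP := im _ E; rewrite mulf_eq0 => /orP[/eqP//|].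
  by rewrite (negPf w_im).
have /eqP := im _ E.
rewrite [w ^+ _](@w_sqr R) mulf_eq0 => /orP[/eqP//|].
rewrite /= oppr0 addr0 oppr_eq0.
by rewrite (negPf w_im).
Qed.

Lemma sqrt23_bounds : [/\ 0 < Num.sqrt 2 :> R,
  Num.sqrt 2 < Num.sqrt 2 * Num.sqrt 3 :> R &
  Num.sqrt 2 * Num.sqrt 3 < Num.sqrt 2 * 2%:R :> R].
Proof.
have s2 : 0 < Num.sqrt 2 :> R by rewrite sqrtr_gt0 ltr0n.
have s3 : 0 < Num.sqrt 3 :> R by rewrite sqrtr_gt0 ltr0n.
have s3s : Num.sqrt 3 * Num.sqrt 3 = 3 :> R by rewrite -expr2 sqr_sqrtr ?ler0n.
by split=> //; [rewrite -[ltLHS]mulr1 ltr_pM2l //; nra | rewrite ltr_pM2l //; nra].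
Qed.

Lemma spoint_radius_inj (i j : 'I_4) : spoint_radius i = spoint_radius j -> i = j.
Proof.
have [s0 s1 s2] := sqrt23_bounds.
case: i j => [[|[|[|[|i]]]] lt_i] [[|[|[|[|j]]]] lt_j] //=;
  by [move=> _; apply: val_inj | move=> E; exfalso; lra].
Qed.

Lemma spoint_radius_neq0 i : spoint_radius i != 0.
Proof.
have [s0 s1 s2] := sqrt23_bounds.
by apply/eqP; case: i => [|[|[|i]]] /= E; lra.
Qed.

Lemma wD (j k : 'Z_3) : w ^+ (j + k : 'Z_3)%R = w ^+ j * w ^+ k.
Proof.
rewrite -exprD (divn_eq (j + k)%N 3) exprD mulnC exprM (@w_cube R) expr1n mul1r.
by [].
Qed.

Lemma spoint_inj : injective spoint.
Proof.
have nz i k : Some ((spoint_radius i)%:C * w ^+ k) <> Some 0 :> sphere.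
  move=> /Some_inj/eqP; rewrite mulf_eq0 expf_eq0 (negPf w_neq0) andbF orbF.
  by rewrite eq_complex /= eqxx andbT (negPf (spoint_radius_neq0 i)).
move=> [[]|[i j]] [[]|[k l]] //=.
- by move=> /esym/nz.
- by move=> /nz.
move=> /Some_inj E; have [jl|jl] := eqVneq j l.
  move: E; rewrite jl => /mulIf -/(_ (expf_neq0 _ w_neq0)) /(congr1 (@complex.Re R)) /=.
  by move=> /spoint_radius_inj ->.
have : (spoint_radius i)%:C * w ^+ (j - l : 'Z_3)%R = (spoint_radius k)%:C.
  by rewrite wD mulrA E -mulrA -wD subrr mulr1.
move=> /real_mul_w; rewrite subr_eq0 => /(_ jl) /eqP.
by rewrite (negPf (spoint_radius_neq0 i)).
Qed.

Lemma spoint_rot u : rot_w (spoint u) = spoint (rot_label u).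
Proof.
case: u => [[]|[i k]].
- by rewrite /= eqxx.
- by rewrite /= !(mulr0, mul0r, add0r, addr0) oner_eq0 ?mul0r.
rewrite [LHS]/= mul0r add0r oner_eq0 addr0 divr1 /rot_label /spoint wD.
by rewrite mulrCA [w * _]mulrC.
Qed.

Lemma spoint_radiusE i : (spoint_radius i)%:C = match i with
  | 0 => sqrt2
  | 1 => - (sqrt2 / 2%:R)
  | 2 => - (sqrt2 * (1 + sqrt3) / 2%:R)
  | _ => sqrt2 * (sqrt3 - 1) / 2%:R
  end.
Proof.
have half : 2%:R^-1 = (2%:R^-1)%:C :> C by rewrite fmorphV rmorph_nat.
by case: i => [|[|[|i]]] /=; rewrite /sqrt2 /sqrt3 ?half; apply/eqP; rewrite eq_complex /=;
  apply/andP; split; apply/eqP; ring.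
Qed.

Let edge_turnK z : edge_turn (edge_turn z) = z :> sphere.
Proof. by have /(congr1 (fun f => f z)) := a4r_aa (@tetrahedral_relations R). Qed.

(** On homogeneous coordinates the image of [x] is an equality of vectors up to
    the factor [sqrt2 * x + 1]; that factor is nonzero because it divides a
    nonzero integer. *)
Lemma spoint_turn u : edge_turn (spoint u) = spoint (turn_label u).
Proof.
have [w2 s2 s3] := And3 (@w_sqr R) (@sqrt2_sqr R) (@sqrt3_sqr R).
have n3 := @three_neq0 R.
have neq0_of (k l c : C) : c != 0 -> k * l = c -> k != 0.
  by move=> c0 E; apply: contra_neq c0 => k0; rewrite -E k0 mul0r.
have turnE (x x' k : C) : k != 0 -> sqrt2 * x + 1 = k -> - x + sqrt2 = k * x' ->
    edge_turn (Some x) = Some x'.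
  move=> k0 E1 E2; apply: (@lft_eq _ _ _ _ _ k) => //.
  by rewrite /mat_act /scale_pt /= !mulr1 E1 -E2 mulN1r.
pose point i k : sphere := Some ((spoint_radius i)%:C * w ^+ k).
have F0 : edge_turn (Some 0) = Some sqrt2.
  by apply: (turnE _ _ 1); rewrite ?oner_eq0 //; ring.
have V0 : edge_turn None = Some (- (sqrt2 / 2%:R)).
  apply: (@lft_eq _ _ _ _ _ sqrt2); first exact: sqrt2_neq0.
  rewrite /mat_act /scale_pt /=; congr (_, _); last by ring.
  by field: s2.
have F1 : edge_turn (Some (sqrt2 * w)) = Some (sqrt2 * w ^+ 2).
  apply: (turnE _ _ (2%:R * w + 1)).
  - apply: (neq0_of _ (2%:R * w + 1) (- 3%:R)); first by rewrite oppr_eq0.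
    by ring: w2.
  - by ring: s2.
  - by ring: w2.
have V1 : edge_turn (Some (- (sqrt2 / 2%:R) * w)) = Some (- (sqrt2 / 2%:R) * w ^+ 2).
  apply: (turnE _ _ (1 - w)).
  - by apply: (neq0_of _ (1 - w ^+ 2) 3%:R) => //; ring: w2.
  - by field: s2.
  - by field: w2.
have E0 : edge_turn (Some (- (sqrt2 * (1 + sqrt3) / 2%:R))) =
    Some (- (sqrt2 * (1 + sqrt3) / 2%:R)).
  apply: (turnE _ _ (- sqrt3)).
  - by apply: (neq0_of _ (- sqrt3) 3%:R) => //; ring: s3.
  - by field: s2.
  - by field: s3.
have E0' : edge_turn (Some (sqrt2 * (sqrt3 - 1) / 2%:R)) = Some (sqrt2 * (sqrt3 - 1) / 2%:R).
  apply: (turnE _ _ sqrt3).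
  - by apply: (neq0_of _ sqrt3 3%:R) => //; ring: s3.
  - by field: s2.
  - by field: s3.
have E1 : edge_turn (Some (- (sqrt2 * (1 + sqrt3) / 2%:R) * w)) =
    Some (sqrt2 * (sqrt3 - 1) / 2%:R * w).
  apply: (turnE _ _ (1 - w * (1 + sqrt3))).
  - apply: (neq0_of _ ((1 - w ^+ 2 * (1 + sqrt3)) * (2%:R - sqrt3)) 3%:R) => //.
    by ring: w2 s3.
  - by field: s2.
  - by field: w2 s3.
have E2 : edge_turn (Some (- (sqrt2 * (1 + sqrt3) / 2%:R) * w ^+ 2)) =
    Some (sqrt2 * (sqrt3 - 1) / 2%:R * w ^+ 2).
  apply: (turnE _ _ (1 - w ^+ 2 * (1 + sqrt3))).
  - apply: (neq0_of _ ((1 - w * (1 + sqrt3)) * (2%:R - sqrt3)) 3%:R) => //.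
    by ring: w2 s3.
  - by field: s2.
  - by field: w2 s3.
case: u => [[]|[[[|[|[|[|i]]]] lt_i] k]] //.
- by change (edge_turn None = point 1 0); rewrite /point spoint_radiusE expr0 mulr1.
- by change (edge_turn (Some 0) = point 0 0); rewrite /point spoint_radiusE expr0 mulr1.
- elim/Z3_ind: k.
  + change (edge_turn (point 0 0) = Some 0).
    by rewrite /point !spoint_radiusE ?expr0 ?expr1 ?mulr1 -F0 edge_turnK.
  + change (edge_turn (point 0 1) = point 0 2).
    by rewrite /point !spoint_radiusE ?expr0 ?expr1 ?mulr1 F1.
  + change (edge_turn (point 0 2) = point 0 1).
    by rewrite /point !spoint_radiusE ?expr0 ?expr1 ?mulr1 -F1 edge_turnK.
- elim/Z3_ind: k.
  + change (edge_turn (point 1 0) = None).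
    by rewrite /point !spoint_radiusE ?expr0 ?expr1 ?mulr1 -V0 edge_turnK.
  + change (edge_turn (point 1 1) = point 1 2).
    by rewrite /point !spoint_radiusE ?expr0 ?expr1 ?mulr1 V1.
  + change (edge_turn (point 1 2) = point 1 1).
    by rewrite /point !spoint_radiusE ?expr0 ?expr1 ?mulr1 -V1 edge_turnK.
- elim/Z3_ind: k.
  + change (edge_turn (point 2 0) = point 2 0).
    by rewrite /point !spoint_radiusE ?expr0 ?expr1 ?mulr1 E0.
  + change (edge_turn (point 2 1) = point 3 1).
    by rewrite /point !spoint_radiusE ?expr0 ?expr1 ?mulr1 E1.
  + change (edge_turn (point 2 2) = point 3 2).
    by rewrite /point !spoint_radiusE ?expr0 ?expr1 ?mulr1 E2.
- elim/Z3_ind: k.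
  + change (edge_turn (point 3 0) = point 3 0).
    by rewrite /point !spoint_radiusE ?expr0 ?expr1 ?mulr1 E0'.
  + change (edge_turn (point 3 1) = point 2 1).
    by rewrite /point !spoint_radiusE ?expr0 ?expr1 ?mulr1 -E1 edge_turnK.
  + change (edge_turn (point 3 2) = point 2 2).
    by rewrite /point !spoint_radiusE ?expr0 ?expr1 ?mulr1 -E2 edge_turnK.
Qed.

End SpecialPoints.

(** * Points with a rotation axis *)

Section SpecialSets.
Local Open Scope classical_set_scope.
Local Open Scope ring_scope.
Local Open Scope complex_scope.
Context {R : realType}.
Local Notation C := R[i].
Local Notation sphere := (@sphere R).
Local Notation w := (@w R).
Local Notation sqrt2 := (@sqrt2 R).
Local Notation sqrt3 := (@sqrt3 R).
Local Notation spoint := (@spoint R).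

Definition special kF kV kE : set sphere := spoint @` [set u | of_kind kF kV kE u].

Lemma specialU kF kV kE kF' kV' kE' :
  special kF kV kE `|` special kF' kV' kE' = special (kF || kF') (kV || kV') (kE || kE').
Proof.
rewrite /special -image_setU; congr (_ @` _); apply/seteqP; split=> u /=.
  by case: u => [[]|[[[|[|[|[|i]]]] lt_i] k]] //= [] ->; rewrite ?orbT.
by case: u => [[]|[[[|[|[|[|i]]]] lt_i] k]] //= /orP.
Qed.

Lemma special0 : special false false false = set0.
Proof.
apply/seteqP; split=> // z [u] /=.
by case: u => [[]|[[[|[|[|[|i]]]] lt_i] k]].
Qed.

Let pointsE (i : 'I_4) (c : C) : (@spoint_radius R i)%:C = c ->
  [set Some (c * w ^+ k) | k in `I_3] = [set spoint (inr (i, k)) | k in [set: 'Z_3]].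
Proof.
move=> <-; apply/seteqP; split=> z [k].
  by move=> k3 <-; exists (inZp k) => //=; rewrite /= modn_small.
by move=> _ <-; exists k => //=; exact: ltn_ord.
Qed.

Lemma F_TE : @F_T R = special true false false.
Proof.
rewrite /F_T (pointsE (i := 0)); last by rewrite spoint_radiusE.
apply/seteqP; split=> z.
  by case=> [->|[k _ <-]]; [exists (inl false) | exists (inr (0, k))].
case=> -[[]|[[[|[|[|[|i]]]] lt_i] k]] //= _ <-; first by left.
by right; exists k.
Qed.

Lemma V_TE : @V_T R = special false true false.
Proof.
rewrite /V_T (pointsE (i := 1)); last first.
  by rewrite spoint_radiusE; field: (@sqrt2_sqr R); exact: sqrt2_neq0.
apply/seteqP; split=> z.
  by case=> [->|[k _ <-]]; [exists (inl true) | exists (inr (1, k))].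
case=> -[[]|[[[|[|[|[|i]]]] lt_i] k]] //= _ <-; first by left.
by right; exists k.
Qed.

Let nz1 : 1 - sqrt3 != 0.
Proof.
apply/eqP => E; have s3 := @sqrt3_sqr R.
have : (1 - sqrt3) * (- (1 + sqrt3)) = 2%:R by ring: s3.
by rewrite E mul0r => /eqP; rewrite eq_sym pnatr_eq0.
Qed.

Let nz2 : 1 + sqrt3 != 0.
Proof.
apply/eqP => E; have s3 := @sqrt3_sqr R.
have : (1 + sqrt3) * (sqrt3 - 1) = 2%:R by ring: s3.
by rewrite E mul0r => /eqP; rewrite eq_sym pnatr_eq0.
Qed.

Lemma E_TE : @E_T R = special false false true.
Proof.
rewrite /E_T (pointsE (i := 2%:R)); last by rewrite spoint_radiusE; field: (@sqrt3_sqr R).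
rewrite (pointsE (i := 3%:R)); last by rewrite spoint_radiusE; field: (@sqrt3_sqr R).
apply/seteqP; split=> z.
  by case=> [[k _ <-]|[k _ <-]]; [exists (inr (2%:R, k)) | exists (inr (3%:R, k))].
case=> -[[]|[[[|[|[|[|i]]]] lt_i] k]] //= _ <-; [left|right]; exists k => //.
Qed.

Lemma trot_label x u : exists u', trot x (spoint u) = spoint u' /\
  forall kF kV kE, of_kind kF kV kE u' = of_kind kF kV kE u.
Proof.
pose ok (f : sphere -> sphere) := forall u, exists u', f (spoint u) = spoint u' /\
  forall kF kV kE, of_kind kF kV kE u' = of_kind kF kV kE u.
have ok_comp f g : ok f -> ok g -> ok (f \o g).
  move=> okf okg v; have [v' [E1 E2]] := okg v; have [v'' [E3 E4]] := okf v'.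
  by exists v''; rewrite /= E1 E3; split=> // *; rewrite E4 E2.
have ok_id : ok id by move=> v; exists v.
have ok_r : ok rot_w.
  by move=> v; exists (rot_label v); rewrite spoint_rot; split=> // *; exact: of_kind_rot.
have ok_a : ok edge_turn.
  by move=> v; exists (turn_label v); rewrite spoint_turn; split=> // *; exact: of_kind_turn.
have ok_b : ok edge_turn' by exact: ok_comp (ok_comp _ _ ok_r ok_a) (ok_comp _ _ ok_r ok_r).
suff : ok (trot x) by exact.
rewrite /trot /a4_word /klein_word; apply: (ok_comp).
  by apply: (ok_comp); case: ifP.
by elim: (x.2 : nat) => [|k IH] /=; [exact: ok_id | exact: (ok_comp)].
Qed.

Lemma spoint_axis u : has_rotation_axis (spoint u).
Proof.
have axis_inl b : has_rotation_axis (spoint (inl b)).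
  by exists ((false, false), 1) => //; rewrite -[LHS]/(rot_w (spoint (inl b))) spoint_rot.
have edgeE : edge_turn = trot ((true, false), 0) :> (sphere -> sphere) by [].
have axis0 (i : 'I_4) : has_rotation_axis (spoint (inr (i, 0))).
  case: i => [[|[|[|[|i]]]] lt_i] //.
  - rewrite (_ : inr _ = turn_label (inl false)); last by congr (inr (_, _)); apply: val_inj.
    by rewrite -spoint_turn edgeE; exact: has_rotation_axis_trot.
  - rewrite (_ : inr _ = turn_label (inl true)); last by congr (inr (_, _)); apply: val_inj.
    by rewrite -spoint_turn edgeE; exact: has_rotation_axis_trot.
  - by exists ((true, false), 0) => //; rewrite -edgeE spoint_turn.
  - by exists ((true, false), 0) => //; rewrite -edgeE spoint_turn.
case: u => [b|[i k]]; first exact: axis_inl.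
have rotE z : rot_w z = trot ((false, false), 1) z :> sphere by [].
have axis1 j : has_rotation_axis (spoint (inr (i, j))) ->
    has_rotation_axis (spoint (inr (i, j + 1))).
  rewrite -[inr (i, j + 1)]/(rot_label (inr (i, j))) -spoint_rot rotE.
  exact: has_rotation_axis_trot.
elim/Z3_ind: k; first exact: axis0.
  by rewrite -[1]add0r; apply: axis1; exact: axis0.
rewrite (_ : -1 = 0 + 1 + 1 :> 'Z_3); last by apply: val_inj.
by do 2!apply: (axis1); exact: axis0.
Qed.

Lemma turn_label_fix u : turn_label u = u -> u = inr (2%:R, 0) \/ u = inr (3%:R, 0).
Proof.
have E (i j : 'I_4) (k l : 'Z_3) : inr (i, k) = inr (j, l) :> label -> i = j /\ k = l by case.
case: u => [[]|[[[|[|[|[|i]]]] lt_i] k]] //.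
- by elim/Z3_ind: k => // /E[_].
- by elim/Z3_ind: k => // /E[_].
- elim/Z3_ind: k; [|by case/E..]; move=> _; left; congr (inr (_, _)); exact: val_inj.
- elim/Z3_ind: k; [|by case/E..]; move=> _; right; congr (inr (_, _)); exact: val_inj.
Qed.

Lemma rot_label_fix u : rot_label u = u -> exists b, u = inl b.
Proof.
case: u => [b|[i k]]; first by exists b.
have E (j l : 'Z_3) : inr (i, j) = inr (i, l) :> label -> j = l by case.
by elim/Z3_ind: k => /E.
Qed.

End SpecialSets.

(** * Configurations of a given type *)

Section TypedConfiguration.
Local Open Scope classical_set_scope.
Local Open Scope ring_scope.
Local Open Scope complex_scope.
Context {R : realType} {d : nat} {lam : 'rV[R[i]]_d} (lamK : Kn lam).
Local Notation C := R[i].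
Local Notation V := 'rV[C]_d.
Local Notation sphere := (@sphere R).
Local Notation w := (@w R).
Context {psi : sphere -> sphere} {kF kV kE : bool} {m : nat}.
Context (psi_type : carries_onto_type psi lam (@special R kF kV kE) m).
Local Notation y i := (psi (zpt lam i)).
Local Notation kind := (of_kind kF kV kE).

Lemma carries_lft : is_lft psi. Proof. by case: psi_type. Qed.

Let y_inj : injective (fun i => y i).
Proof. by move=> i j /(is_lft_inj carries_lft)/((KnP lam).1 lamK). Qed.

(** The points [pt i] are base points of the orbits of order twelve.  These orbits
    are free, so none of their points has a rotation axis, and they are disjoint
    from the other part of the configuration. *)
Lemma carried_points : exists pt : 'I_m -> sphere,
  [/\ injective (fun ix : 'I_m * a4 => trot ix.2 (pt ix.1)),
      forall i x, ~ has_rotation_axis (trot x (pt i))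
    & forall z, (exists i, z = y i) <->
        (exists2 u, kind u & z = spoint u) \/ (exists i x, z = trot x (pt i))].
Proof.
have [_ [B [B_inj B_T SE]]] := psi_type.
have /choice[pt ptE] : forall i, exists z, B i = T_orbit z by move=> i; case: (B_T i).
have pt_free i : injective (fun x => trot x (pt i)).
  by apply: T_orbit_free; rewrite -ptE.
have orbit_trot x (z : sphere) : T_orbit (trot x z) = T_orbit z.
  rewrite !T_orbitE; apply/seteqP; split=> _ [t _ <-].
    by exists (a4_mul t x) => //; rewrite -trotM.
  by exists (a4_mul t (a4_inv x)) => //; rewrite -trotM /= trotK.
exists pt; split.
- move=> [i x] [j z] /= E.
  have ij : i = j by apply: B_inj; rewrite !ptE -(orbit_trot x) E orbit_trot.
  by move: E; rewrite ij => /pt_free ->.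
- by move=> i x; apply: (free_no_axis (pt_free i)); rewrite T_orbitE; exists x.
- move=> z; have -> : (exists i, z = y i) <-> [set psi z | z in zset lam] z.
    split; first by move=> [i ->]; exists (zpt lam i) => //; exists i.
    by move=> [_ [i _ <-] <-]; exists i.
  rewrite SE; split.
    move=> [[u ku <-]|[i _]]; first by left; exists u.
    by rewrite ptE T_orbitE => -[x _ <-]; right; exists i, x.
  move=> [[u ku ->]|[i [x ->]]]; first by left; exists u.
  by right; exists i => //; rewrite ptE T_orbitE; exists x.
Qed.

Lemma carried_invariant x i : exists j, trot x (y i) = y j.
Proof.
have [pt [_ _ ptP]] := carried_points.
have [[u ku E]|[j [z E]]] := (ptP (y i)).1 (ex_intro _ i erefl).
  have [u' [E' kE']] := @trot_label R x u.
  have [j jE] : exists j, spoint u' = y j by apply: (ptP _).2; left; exists u'; rewrite ?kE'.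
  by exists j; rewrite -jE -E' E.
have [k kkE] : exists k, trot (a4_mul x z) (pt j) = y k.
  by apply: (ptP _).2; right; exists j, (a4_mul x z).
by exists k; rewrite -kkE E -trotM.
Qed.

(** Each of the m free orbits contributes twelve points. *)
Lemma carried_card : (3 + d = 4 * kF + 4 * kV + 6 * kE + m * 12)%N.
Proof.
have [pt [pt_inj pt_axis ptP]] := carried_points.
have pt_sp j t z : spoint t <> trot z (pt j).
  by move=> E; apply: (pt_axis j z); rewrite -E; exact: spoint_axis.
pose D := [set u | kind u]%SET.
pose P (t : {u | u \in D} + 'I_m * a4) : sphere :=
  match t with inl u => spoint (val u) | inr ix => trot ix.2 (pt ix.1) end.
have P_inj : injective P.
  move=> [u|ix] [v|jz] /=.
  - by move=> /spoint_inj/val_inj ->.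
  - by move=> /pt_sp.
  - by move=> /esym/pt_sp.
  - by move=> /pt_inj ->.
have /choice[g gP] : forall t, exists i, P t = y i.
  move=> [u|ix] /=; apply: (ptP _).2; [left|right].
    by exists (val u) => //; have := valP u; rewrite inE.
  by exists ix.1, ix.2.
have /choice[h hP] : forall i, exists t, y i = P t.
  move=> i; have [[u ku E]|[j [z E]]] := (ptP (y i)).1 (ex_intro _ i erefl).
    have uD : u \in D by rewrite inE.
    by exists (inl (exist _ u uD)).
  by exists (inr (j, z)).
have g_inj : injective g by move=> s t E; apply: P_inj; rewrite !gP E.
have h_inj : injective h by move=> s t E; apply: y_inj; rewrite !hP E.
have := leq_card _ g_inj; have := leq_card _ h_inj.
rewrite card_sum card_sig card_prod !card_ord /= => le1 le2.
have cD : #|[pred x | x \in D]| = (4 * kF + 4 * kV + 6 * kE)%N.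
  by rewrite -(card_of_kind kF kV kE); apply: eq_card => u; rewrite !inE.
have ca4 : #|{: a4}| = 12%N by rewrite !card_prod !card_bool card_ord.
rewrite cD ca4 in le1 le2.
by apply/eqP; rewrite eqn_leq le1 le2.
Qed.

(** Here [P] stands for being fixed by a rotation, which has two fixed points.
    They have a rotation axis, so they belong to the configuration exactly when
    their kind is admitted. *)
Lemma sum_two_fixed (P : pred sphere) (G : sphere -> C) u v : u != v ->
  (forall t, P (spoint t) <-> t = u \/ t = v) ->
  (forall z, P z -> has_rotation_axis z) ->
  \sum_(i | P (y i)) G (y i) = (kind u)%:R * G (spoint u) + (kind v)%:R * G (spoint v).
Proof.
move=> uv PE Paxis.
have [pt [pt_inj pt_axis ptP]] := carried_points.
have pt_sp j t z : spoint t <> trot z (pt j).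
  by move=> E; apply: (pt_axis j z); rewrite -E; exact: spoint_axis.
have sumE t : \sum_i (`[< y i = spoint t >])%:R * G (y i) = (kind t)%:R * G (spoint t).
  have [kt|kt] := boolP (kind t).
    have [j jE] : exists j, spoint t = y j by apply: (ptP _).2; left; exists t.
    rewrite (bigD1 j) //= -jE asboolT // big1 ?addr0 // => i ij.
    case: asboolP; last by rewrite mul0r.
    by rewrite jE => /y_inj ji; rewrite ji eqxx in ij.
  rewrite mul0r big1 // => i _; case: asboolP; last by rewrite mul0r.
  move=> E; have [[t' kt' E']|[j [z E']]] := (ptP (y i)).1 (ex_intro _ i erefl).
    by move: E'; rewrite E => /spoint_inj tt'; rewrite tt' kt' in kt.
  by have := pt_sp j t z; rewrite -E E'.
rewrite -(sumE u) -(sumE v) -big_split big_mkcond; apply: eq_bigr => i _ /=.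
have neq : spoint u <> spoint v :> sphere by move=> /spoint_inj/eqP; rewrite (negPf uv).
case: (asboolP (y i = spoint u)) => [->|nu].
  by rewrite (PE u).2; [rewrite asboolF // mul1r mul0r addr0 | left].
case: (asboolP (y i = spoint v)) => [->|nv].
  by rewrite (PE v).2; [rewrite mul1r mul0r add0r | right].
rewrite !mul0r addr0; case: ifP => // Pi.
have [[t kt E]|[j [z E]]] := (ptP (y i)).1 (ex_intro _ i erefl).
  by move: Pi; rewrite E => /PE[] tE; [case: nu | case: nv]; rewrite E tE.
by have := Paxis _ Pi; rewrite E => /pt_axis.
Qed.

End TypedConfiguration.

(** * Traces of the lifted rotations *)

Section TypedStabilizer.
Local Open Scope classical_set_scope.
Local Open Scope ring_scope.
Local Open Scope complex_scope.
Context {R : realType} {d : nat} {lam : 'rV[R[i]]_d} (lamK : Kn lam).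
Local Notation C := R[i].
Local Notation V := 'rV[C]_d.
Local Notation sphere := (@sphere R).
Local Notation w := (@w R).
Local Notation sqrt2 := (@sqrt2 R).
Context {psi : sphere -> sphere} {kF kV kE : bool} {m : nat}.
Context (psi_type : carries_onto_type psi lam (@special R kF kV kE) m).
Local Notation y i := (psi (zpt lam i)).
Local Notation theta := (lift_trot lamK (carries_lft psi_type) (carried_invariant psi_type)).
Local Notation a := (theta ((true, false), 0)).
Local Notation b := (theta ((false, true), 0)).
Local Notation r := (theta ((false, false), 1)).

Let fixed_axis x : x != a4_one -> forall z : sphere, `[< trot x z = z >] -> has_rotation_axis z.
Proof. by move=> x1 z /asboolP xz; exists x. Qed.

(** The half turn fixes two opposite edge midpoints, with multiplier -1; its trace
    on the vector fields is -1. *)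
Lemma mxtrace_a : \tr (X_ lam a) = 1 - 2%:R * kE%:R.
Proof.
have s2 := @sqrt2_sqr R.
have aE : trot ((true, false), 0) = lft (-1) sqrt2 sqrt2 1 by [].
pose eta (z : sphere) : C := if z is Some x then sqrt2 * x + 1 else 0.
have etaP (z : sphere) : trot ((true, false), 0) z = z ->
    mat_act (-1) sqrt2 sqrt2 1 (hcoord z) = scale_pt (eta z) (hcoord z).
  rewrite -[trot _ z]/(edge_turn z) /edge_turn; case: z => [x|] /=; last first.
    by rewrite (negPf (@sqrt2_neq0 R)).
  case: eqP => // /eqP k0 /Some_inj E; rewrite /mat_act /scale_pt /=.
  congr (_, _); last by ring.
  by rewrite mulr1 -[LHS](divfK k0) E mulrC.
rewrite (mxtrace_lift_trot lamK (carries_lft psi_type) (carried_invariant psi_type)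
  (@edge_turn_det0 R) aE etaP).
rewrite (sum_two_fixed lamK psi_type (P := fun z => `[< trot ((true, false), 0) z = z >])
  (fun z => (-1 * 1 - sqrt2 * sqrt2) / eta z ^+ 2) (u := inr (2%:R, 0)) (v := inr (3%:R, 0))) //.
- have s3 := @sqrt3_sqr R; have n3 := @three_neq0 R.
  have eta2 : eta (spoint (inr (2%:R, 0))) ^+ 2 = 3%:R.
    by rewrite /eta /spoint spoint_radiusE expr0 mulr1; field: s2 s3.
  have eta3 : eta (spoint (inr (3%:R, 0))) ^+ 2 = 3%:R.
    by rewrite /eta /spoint spoint_radiusE expr0 mulr1; field: s2 s3.
  rewrite edge_turn_det eta2 eta3 /=.
  by field.
- move=> t; split=> [/asboolP|].
    rewrite -[trot _ _]/(edge_turn _) spoint_turn => /spoint_inj; exact: turn_label_fix.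
  by move=> [->|->]; apply/asboolP; rewrite -[trot _ _]/(edge_turn _) spoint_turn.
- exact: fixed_axis.
Qed.

(* The rotation z |-> c z fixes 0 and infinity, with multipliers c and c^-1. *)
Let sum_diag (x : a4) (c : C) (c0 : c != 0) : x != a4_one -> trot x = lft c 0 0 1 ->
  (forall u, trot x (spoint u) = spoint u :> sphere -> exists b, u = inl b) ->
  (forall b, trot x (spoint (inl b)) = spoint (inl b) :> sphere) ->
  \tr (X_ lam (theta x)) = c * kF%:R + c^-1 * kV%:R - ((c + 1) ^+ 2 / c - 1).
Proof.
move=> x1 xE fix_inl inl_fix.
pose eta (z : sphere) : C := if z is Some x then 1 else c.
have det0 : c * 1 - 0 * 0 != 0 by rewrite mulr1 mulr0 subr0.
have etaP (z : sphere) : trot x z = z -> mat_act c 0 0 1 (hcoord z) = scale_pt (eta z) (hcoord z).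
  rewrite xE; case: z => [t|] /=; last by rewrite /mat_act /scale_pt /= !mulr0 !mul0r !addr0.
  rewrite mul0r add0r oner_eq0 addr0 divr1 => /Some_inj E.
  by rewrite /mat_act /scale_pt /= E !mul0r !mul1r addr0 add0r.
rewrite (mxtrace_lift_trot lamK (carries_lft psi_type) (carried_invariant psi_type)
  det0 xE etaP).
rewrite (sum_two_fixed lamK psi_type (P := fun z => `[< trot x z = z >])
  (fun z => (c * 1 - 0 * 0) / eta z ^+ 2) (u := inl false) (v := inl true)) //.
- by rewrite /eta /= !mulr1 !mulr0 !subr0; field.
- move=> t; split=> [/asboolP/fix_inl[[] ->]|]; [by right|by left|].
  by move=> [->|->]; apply/asboolP; exact: inl_fix.
- exact: fixed_axis.
Qed.

Lemma mxtrace_r : \tr (X_ lam r) = w * kF%:R + w ^+ 2 * kV%:R.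
Proof.
have w0 := @w_neq0 R; have w2 := @w_sqr R.
have wV : w^-1 = w ^+ 2 by apply: (mulfI w0); rewrite mulfV // -exprS (@w_cube R).
rewrite (sum_diag w0) //.
- rewrite (_ : _ / w = 1) ?subrr ?subr0 ?wV //.
  by rewrite (_ : (w + 1) ^+ 2 = w) ?divff //; ring: w2.
- move=> u; rewrite -[trot _ _]/(rot_w _) spoint_rot => /spoint_inj.
  exact: rot_label_fix.
- by move=> b0; rewrite -[trot _ _]/(rot_w _) spoint_rot.
Qed.

Lemma mxtrace_rr : \tr (X_ lam r *m X_ lam r) = w ^+ 2 * kF%:R + w * kV%:R.
Proof.
have w0 := @w_neq0 R; have w2 := @w_sqr R.
have wV : (w ^+ 2)^-1 = w.
  by apply: (mulfI (expf_neq0 2 w0)); rewrite mulfV ?expf_neq0 // -exprSr (@w_cube R).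
have [_ XM] := stabilizer_rep lamK.
rewrite -XM; try exact: lift_trot_stabilizer.
rewrite lift_trotM (_ : a4_mul _ _ = ((false, false), -1)); last exact: a4_eq.
rewrite (sum_diag (expf_neq0 2 w0)) //.
- rewrite (_ : _ / w ^+ 2 = 1) ?subrr ?subr0 ?wV //.
  rewrite (_ : (w ^+ 2 + 1) ^+ 2 = w ^+ 2) ?divff ?expf_neq0 //; ring: w2.
- by rewrite -rot_w2E.
- move=> u; rewrite -[trot _ _]/(rot_w (rot_w _)) !spoint_rot => /spoint_inj.
  move=> E; apply: (@rot_label_fix u); case: u E => [//|[i k]].
  by elim/Z3_ind: k.
- by move=> b0; rewrite -[trot _ _]/(rot_w (rot_w _)) !spoint_rot.
Qed.

End TypedStabilizer.

(** * Multiplicity vectors *)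

Section MultiplicityVectors.
Local Open Scope classical_set_scope.
Local Open Scope ring_scope.
Local Open Scope complex_scope.
Context {R : realType} {d : nat} {lam : 'rV[R[i]]_d} (hn : (5 <= 3 + d)%N).
Context (lamK : Kn lam) (hT : group_iso (stabilizer lam) (@T R)).
Local Notation C := R[i].
Local Notation V := 'rV[C]_d.
Local Notation sphere := (@sphere R).
Local Notation w := (@w R).
Context {psi : sphere -> sphere} {kF kV kE : bool} {m : nat}.
Context (psi_type : carries_onto_type psi lam (@special R kF kV kE) m).
Local Notation theta := (lift_trot lamK (carries_lft psi_type) (carried_invariant psi_type)).
Local Notation a := (theta ((true, false), 0)).
Local Notation b := (theta ((false, true), 0)).
Local Notation r := (theta ((false, false), 1)).

Let thetaM := lift_trotM lamK (carries_lft psi_type) (carried_invariant psi_type).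
Let theta1 := lift_trot1 lamK (carries_lft psi_type) (carried_invariant psi_type).
Let rel : a4_relations (@comp V V V) id a b r :=
  a4_morphism_relations thetaM theta1 (fun _ _ _ => erefl) (fun _ => erefl) (fun _ => erefl).

Let thetaE x : a4_word (@comp V V V) id a b r x = theta x.
Proof. by rewrite -(a4_morphism_word thetaM theta1). Qed.

Let repX := stabilizer_rep lamK.

(* The trace of a is 1 or -1, whereas that of the identity is d >= 2. *)
Let a_neq_id : a <> id.
Proof.
move=> a1; have := mxtrace_a lamK psi_type; rewrite a1 (proj1 repX) mxtrace1.
case: kE => E.
  have : (d.+1%:R : C) = 0 by rewrite -natr1 E /=; ring.
  by move/eqP; rewrite pnatr_eq0.
have /eqP : (d%:R : C) = 1%:R by rewrite E mulr0 subr0.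
by rewrite eqr_nat => /eqP d1; move: hn; rewrite d1.
Qed.

Let theta_inj : injective theta.
Proof. by move=> x z; rewrite -(thetaE x) -(thetaE z) => /(a4_word_inj rel a_neq_id). Qed.

(* By hypothesis the stabilizer has as many elements as the tetrahedral group, so
   the injective map theta is onto. *)
Let stabilizerE : stabilizer lam = range (a4_word (@comp V V V) id a b r).
Proof.
have Htheta := lift_trot_stabilizer lamK (carries_lft psi_type) (carried_invariant psi_type).
rewrite eqEsubset; split; last by move=> _ [x _ <-]; rewrite thetaE; apply: Htheta.
move=> h Hh.
have [phi [[phi_fun phi_inj _] _]] := hT.
have T_of f : stabilizer lam f -> exists x, phi f = trot x.
  by move=> /phi_fun; rewrite /= T_range => -[x _ <-]; exists x.
have /choice[mu muP] : forall x, exists z, phi (theta x) = trot z.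
  by move=> x; exact: T_of.
have mu_inj : injective mu.
  move=> x z E; apply: theta_inj; apply: phi_inj; rewrite ?inE //.
  by rewrite !muP E.
have [z zE] := T_of h Hh.
have /codomP[x xE] : z \in codom mu by rewrite (injF_onto mu_inj).
exists x => //; rewrite thetaE; apply: phi_inj; rewrite ?inE //.
by rewrite muP zE xE.
Qed.

Let dE : (d%:R : C) = 4%:R * kF%:R + 4%:R * kV%:R + 6%:R * kE%:R + 12%:R * m%:R - 3%:R.
Proof.
apply: (@addrI _ 3%:R); rewrite -natrD (carried_card lamK psi_type).
by rewrite !natrD !natrM; ring.
Qed.

(* Written with a successor because the multiplicity is 3 m - 1 plus
   contributions of the kinds of points present. *)
Let p4_nat p4 : (p4.+1 = 3 * m + kF + kV + 2 * kE)%N ->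
  4%:R * p4%:R = d%:R - \tr (X_ lam a).
Proof.
move=> p4S.
have E : p4%:R + 1 = 3%:R * m%:R + kF%:R + kV%:R + 2%:R * kE%:R :> C.
  by rewrite natr1 p4S 3!natrD !natrM.
have -> : (p4%:R : C) = 3%:R * m%:R + kF%:R + kV%:R + 2%:R * kE%:R - 1 by rewrite -E; ring.
by rewrite (mxtrace_a lamK psi_type) dE; ring.
Qed.

(** With as many vertices as face centers the values of the character on the two
    classes of elements of order three agree. *)
Lemma symmetric_multiplicity K3 K4 p4 : kF = kV ->
  (p4.+1 = 3 * m + kF + kV + 2 * kE)%N ->
  order3_labelling (stabilizer lam) K3 K4 ->
  multiplicity_vector lam K3 K4 m (kF + m)%N (kF + m)%N p4.
Proof.
move=> kFV /p4_nat p4E K34; have w2 := @w_sqr R.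
have trA := mxtrace_a lamK psi_type.
have trR := mxtrace_r lamK psi_type; have trRR := mxtrace_rr lamK psi_type.
have trE (tA tR tRR : C) : tA = 1 - 2%:R * kE%:R -> tR = w * kF%:R + w ^+ 2 * kV%:R ->
    tRR = w ^+ 2 * kF%:R + w * kV%:R ->
    [/\ tR = tRR, 12%:R * m%:R = d%:R + 3%:R * tA + 8%:R * tR &
        12%:R * (kF + m)%:R = d%:R + 3%:R * tA - 4%:R * tR].
  move=> -> -> ->; rewrite dE natrD kFV; split; first exact: addrC.
    by ring: w2.
  by ring: w2.
have [tr_eq pE qE] := trE _ _ _ trA trR trRR.
exact: (labelled_a4_multiplicities rel a_neq_id stabilizerE repX tr_eq pE qE p4E K34).
Qed.

(** A distinguished rotation is the lift of [rot_w], because a permutation is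
    determined by the way in which its transformation moves the marked points. *)
Lemma distinguished_multiplicity rho p4 :
  (p4.+1 = 3 * m + kF + kV + 2 * kE)%N ->
  is_distinguished_rotation psi lam rho ->
  multiplicity_vector lam (conj_class (stabilizer lam) rho)
    (conj_class (stabilizer lam) (rho \o rho)) m (kF + m)%N (kV + m)%N p4.
Proof.
move=> /p4_nat p4E [[_ rho_fix] [f [s [rhoE fE]] psi_f]]; have w2 := @w_sqr R.
have sE : s = trot_perm lamK (carries_lft psi_type) (carried_invariant psi_type)
    ((false, false), 1).
  apply: (trot_perm_uniq _ _ _ (x := ((false, false), 1)) _ fE psi_f).
  by rewrite -rhoE.
have {rhoE}-> : rho = r by rewrite rhoE sE.
have trA := mxtrace_a lamK psi_type.
have trR := mxtrace_r lamK psi_type; have trRR := mxtrace_rr lamK psi_type.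
have trE (tA tR tRR : C) : tA = 1 - 2%:R * kE%:R -> tR = w * kF%:R + w ^+ 2 * kV%:R ->
    tRR = w ^+ 2 * kF%:R + w * kV%:R ->
    [/\ 12%:R * m%:R = d%:R + 3%:R * tA + 4%:R * (tR + tRR),
        12%:R * (kF + m)%:R = d%:R + 3%:R * tA + 4%:R * ((w ^+ 1) ^+ 2 * tR + w ^+ 1 * tRR) &
        12%:R * (kV + m)%:R = d%:R + 3%:R * tA + 4%:R * (w ^+ 1 * tR + (w ^+ 1) ^+ 2 * tRR)].
  by move=> -> -> ->; rewrite dE !natrD; split; ring: w2.
have [p1E p2E p3E] := trE _ _ _ trA trR trRR.
have := a4_multiplicities_of_traces rel a_neq_id stabilizerE repX (j := 1) isT p1E p2E p3E p4E.
have rrE : a4_word (@comp V V V) id a b r ((false, false), -1) = r \o r by [].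
have rE : a4_word (@comp V V V) id a b r ((false, false), 1) = r by [].
by rewrite rE rrE.
Qed.

End MultiplicityVectors.

Theorem theorem18 (R : realType) (d : nat) (lam : 'rV[R[i]]_d)
    (hn : (5 <= 3 + d)%N) (hlam : Kn lam)
    (hT : group_iso (stabilizer lam) (@T R)) :
  (forall (m : nat) psi rho, (1 <= m)%N ->
     carries_onto_type psi lam F_T m ->
     is_distinguished_rotation psi lam rho ->
     multiplicity_vector lam
       (conj_class (stabilizer lam) rho)
       (conj_class (stabilizer lam) (rho \o rho))
       m (1 + m)%N m (3 * m)%N) /\
  (forall (m : nat) K3 K4, (1 <= m)%N ->
     has_type lam E_T m ->
     order3_labelling (stabilizer lam) K3 K4 ->
     multiplicity_vector lam K3 K4
       m m m (1 + 3 * m)%N) /\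
  (forall (m : nat) K3 K4, (1 <= m)%N ->
     has_type lam (F_T `|` V_T)%classic m ->
     order3_labelling (stabilizer lam) K3 K4 ->
     multiplicity_vector lam K3 K4
       m (1 + m)%N (1 + m)%N (1 + 3 * m)%N) /\
  (forall (m : nat) psi rho,
     carries_onto_type psi lam (F_T `|` E_T)%classic m ->
     is_distinguished_rotation psi lam rho ->
     multiplicity_vector lam
       (conj_class (stabilizer lam) rho)
       (conj_class (stabilizer lam) (rho \o rho))
       m (1 + m)%N m (2 + 3 * m)%N) /\
  (forall (m : nat) K3 K4, (1 <= m)%N ->
     has_type lam (F_T `|` V_T `|` E_T)%classic m ->
     order3_labelling (stabilizer lam) K3 K4 ->
     multiplicity_vector lam K3 K4
       m (1 + m)%N (1 + m)%N (3 + 3 * m)%N) /\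
  (* The source prints the first multiplicity of this last case as m.  It must
     be 1 + m: here n = 12 (1 + m), so the degrees have to add up to
     n - 3 = 9 + 12 m, whereas the printed vector gives 8 + 12 m. *)
  (forall (m : nat) K3 K4,
     has_type lam set0 (1 + m) ->
     order3_labelling (stabilizer lam) K3 K4 ->
     multiplicity_vector lam K3 K4
       (1 + m)%N (1 + m)%N (1 + m)%N (2 + 3 * m)%N).
Proof.
rewrite F_TE V_TE E_TE !specialU -(@special0 R) /=.
split=> [m psi rho _ ht hr|].
  by apply: (distinguished_multiplicity hn hlam hT ht) hr; lia.
split=> [m K3 K4 _ [psi ht] hK|].
  by apply: (symmetric_multiplicity hn hlam hT ht _ _ hK) => //; lia.
split=> [m K3 K4 _ [psi ht] hK|].
  by apply: (symmetric_multiplicity hn hlam hT ht _ _ hK) => //; lia.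
split=> [m psi rho ht hr|].
  by apply: (distinguished_multiplicity hn hlam hT ht) hr; lia.
split=> [m K3 K4 _ [psi ht] hK|m K3 K4 [psi ht] hK].
  by apply: (symmetric_multiplicity hn hlam hT ht _ _ hK) => //; lia.
by apply: (symmetric_multiplicity hn hlam hT ht _ _ hK) => //; lia.
Qed.
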